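(* Consider the repeated second-price auction problem with binary feedback described in the context, under the linear-model, stochastic-HOB and oblivious-context assumptions stated there. There exists a bidding algorithm $\pi$ (which may use $T$, $\omega$, $\lambda$) such that for every problem instance satisfying these assumptions, \[ R(\pi) = O\left(\sqrt{dT}\,\log^3 T + d\log^5 T\right), \] where the constant hidden in $O(\cdot)$ does not depend on $T$, $d$, $\theta_*$, $G$ or the contexts (it may depend on $\omega,\lambda$).
   Context: Setting (repeated second-price auctions, single bidder). There are $T\ge 2$ rounds. At the start of round $t\in\{1,\dots,T\}$ a context $x_t\in\mathbb{R}^d$ with $\|x_t\|_2\le 1$ is revealed. The bidder submits a bid $b_t\in[0,1]$; nature draws the highest other bid (HOB) $m_t\in[0,1]$. If $b_t\ge m_t$ the bidder wins, pays $m_t$ and receives the winning outcome $v_{t,1}\in[0,1]$; if $b_t<m_t$ she loses, pays nothing and receives the baseline outcome $v_{t,0}\in[0,1]$. Thus the payoff of bid $b$ is $r_t(b)=\mathbb{1}[b\ge m_t](v_{t,1}-v_{t,0}-m_t)+v_{t,0}$. Binary feedback: after round $t$ the bidder observes only the win/loss indicator $\mathbb{1}[b_t\ge m_t]$, the realized outcome ($v_{t,1}$ if she won, $v_{t,0}$ if she lost), and the payment $m_t$ if she won (nothing about $m_t$ if she lost). The treatment value $v_{t,1}-v_{t,0}$ is never observed. Assumptions: (Linear model) there is an unknown $\theta_*\in\mathbb{R}^d$ with $\|\theta_*\|_2\le1$ such that $\mathbb{E}[v_{t,1}-v_{t,0}]=\theta_*^\top x_t$ for every $t$. (Stochastic HOB)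 the $m_t$ are i.i.d. with an unknown CDF $G$ on $[0,1]$ which is $(\omega,\lambda)$-locally-bounded for known constants $\omega,\lambda\in(0,1)$, meaning: for all $b_1,b_2\in[0,1]$ with $|b_1-b_2|\le\omega$, $|G(b_1)-G(b_2)|\le\lambda$. (Oblivious context) conditionally on the contexts $(x_t)_{t\le T}$, the tuples $(v_{t,1},v_{t,0},m_t)$, $t=1,\dots,T$, are independent across $t$. Expected payoff: $\overline{r}_t(b)= G(b)\,\theta_*^\top x_t-\int_{[0,b]} m\,\mathrm{d}G(m)+\mathbb{E}[v_{t,0}]$. Regret of an algorithm $\pi$ selecting bids $(b_t)$: $R(\pi)=\mathbb{E}\left[\sum_{t=1}^T\left(\max_{b^*\in[0,1]}\overline{r}_t(b^* )-\overline{r}_t(b_t)\right)\right]$, the expectation over all randomness of the algorithm and the process. *)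

(* Defs.v *)
From HB Require Import structures.
From mathcomp Require Import all_boot all_order all_algebra.
From mathcomp Require Import all_classical all_reals all_analysis.

Set Implicit Arguments.
Unset Strict Implicit.
Unset Printing Implicit Defensive.
Import Order.TTheory GRing.Theory Num.Theory.
Import numFieldNormedType.Exports.
Local Open Scope classical_set_scope.
Local Open Scope ring_scope.

Section Auction.
Variable R : realType.

Definition dotv (d : nat) (a b : 'rV[R]_d) : R := \sum_(i < d) a ord0 i * b ord0 i.
Definition in_unit_ball (d : nat) (a : 'rV[R]_d) : Prop :=
  \sum_(i < d) a ord0 i ^+ 2 <= 1.

(* one entry of the bidder's history:
   (context, own random seed, bid, win indicator, realized outcome,
    payment (= m_t if won, 0 otherwise)) *)
Definition hentry (d : nat) := ('rV[R]_d * R * R * bool * R * R)%type.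

(* a (randomized) bidding policy: round index t (0-based), past history,
   current context, fresh uniform seed u_t in [0,1]  |->  bid *)
Definition policy (d : nat) := nat -> seq (hentry d) -> 'rV[R]_d -> R -> R.

Section Run.
Variables (d : nat) (pol : policy d) (x : nat -> 'rV[R]_d).
Variables (Omega : Type) (V1 V0 M U : nat -> Omega -> R).

Definition bid_of (t : nat) (h : seq (hentry d)) (w : Omega) : R :=
  pol t h (x t) (U t w).

Definition entry_of (t : nat) (h : seq (hentry d)) (w : Omega) : hentry d :=
  let b := bid_of t h w in
  let won := M t w <= b in
  (x t, U t w, b, won, (if won then V1 t w else V0 t w),
   (if won then M t w else 0)).

Fixpoint history (t : nat) (w : Omega) : seq (hentry d) :=
  match t with
  | 0 => [::]
  | t'.+1 => rcons (history t' w) (entry_of t' (history t' w) w)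
  end.

Definition bid (t : nat) (w : Omega) : R := bid_of t (history t w) w.
End Run.

Definition payoff (v1 v0 m b : R) : R :=
  (if m <= b then 1 else 0) * (v1 - v0 - m) + v0.

Definition cdf_of (G : probability R R) (b : R) : R := fine (G `]-oo, b]%classic).

Definition partial_mean (G : probability R R) (b : R) : R :=
  let I : set R := `[0, b]%classic in
  fine (\int[G]_(m in I) m%:E)%E.

Definition locally_bounded (G : probability R R) (om la : R) : Prop :=
  forall b1 b2 : R, 0 <= b1 <= 1 -> 0 <= b2 <= 1 -> `|b1 - b2| <= om ->
    `|cdf_of G b1 - cdf_of G b2| <= la.

Definition rbar (d : nat) (G : probability R R) (theta xt : 'rV[R]_d) (Ev0 : R)
  (b : R) : R :=
  cdf_of G b * dotv theta xt - partial_mean G b + Ev0.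

Definition gap (d : nat) (G : probability R R) (theta xt : 'rV[R]_d) (Ev0 : R)
  (b : R) : R :=
  sup [set rbar G theta xt Ev0 b' | b' in `[0, 1]%classic] - rbar G theta xt Ev0 b.

Definition gen_events (dT dT' : measure_display) (T : measurableType dT)
  (T' : measurableType dT') (X : T -> T') : set (set T) :=
  [set A | exists B : set T', measurable B /\ A = X @^-1` B].

Definition mutually_independent (dT : measure_display) (T : measurableType dT)
  (P : probability T R) (I : eqType) (F : I -> set (set T)) : Prop :=
  forall (J : seq I) (A : I -> set T), uniq J ->
    (forall i, i \in J -> F i (A i)) ->
    fine (P (\bigcap_(i in [set i | i \in J]) A i)) = \prod_(i <- J) fine (P (A i)).

End Auction.

(* Main.v *)
(** Write [tau = theta . x_t], so that bidding [b] instead of [tau] costs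
    [int_(b, tau] (tau - m) dG(m)].  The outcome observed after bidding [b] has
    mean [G(b) tau + E v0]; hence for any [lo < hi] the difference of the outcomes
    at [hi] and [lo] has mean [g tau] with [g = G(hi) - G(lo)], even if the
    outcomes are correlated with the HOB.  This is the only information used on
    [tau]: a probe at scale [w] compares the bids [u - w] and [u + w] around the
    current prediction [u].

    About [sqrt T] initial rounds bidding [1] give estimates of [g] that are
    accurate up to a constant factor as soon as [g] is at least of order
    [ln T / sqrt T].  Then every dyadic scale [w] is probed with probability of
    order [eps / (w g)] where [eps = sqrt (d / T)], so that probing costs [eps]
    per round and scale, and an online Newton step on [g (theta . x_t - tau)^2 / 2]
    updates the prediction.  If the prediction error is [e], the round costs
    about [e g] with [g] the mass at the scale of [e], while the information
    gained is of order [(eps / (w g)) g^2 e^2 ~ eps e g]; as the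
    information totals [O(d ln T)] by the elliptical potential lemma, the regret is
    [O(T eps + d ln T / eps)] up to logarithms.  Only expectations of the potential
    are needed in this argument, never confidence sets for [theta]. *)
Require Import Defs.
From HB Require Import structures.
From mathcomp Require Import all_boot all_order all_algebra.
From mathcomp Require Import all_classical all_reals all_analysis.
From mathcomp Require Import perm measurable_realfun ring lra zify.
Import Order.TTheory GRing.Theory Num.Theory.
Import numFieldNormedType.Exports.
Local Open Scope classical_set_scope.
Local Open Scope ring_scope.
Set Implicit Arguments.
Unset Strict Implicit.
Unset Printing Implicit Defensive.

(** * Rank-one updates of positive definite matrices *)

(** The Newton iterate is never projected, so a prediction may leave [[-1, 1]] by any amount; only
    the bids use the clamped value. The potential argument survives because the second moment of
    [innov] splits into a multiple of the curvature, paid by the growth of [ln (\det A)], and a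
    multiple of the information gained, absorbed by the mean decrease of the squared error once the
    initial matrix is [16%:M].

    The mass estimates are frozen when exploration ends. For a fixed list of exploration outcomes
    the rest is a backward induction on the number of rounds left, with an explicit budget. Failed
    exploration enters the same induction through exponential moments that do not increase in mean,
    so no conditional expectation is ever formed.

    Observations are rounded to a grid of mesh [1 / T]. The history then takes finitely many values,
    regret becomes the finite recursion [rtg] in an abstract environment, and the probability space
    serves only to build that environment and to identify the expected regret with the recursion.
    Rounding biases an outcome difference by at most [1 / T], which costs the potential only
    [O(1 / T^2)] per round. *)

Definition qform (R : realType) (d : nat) (A : 'M[R]_d) (v : 'rV[R]_d) : R :=
  (v *m A *m v^T) ord0 ord0.

Lemma mulmx_trE (R : realType) (d : nat) (a b : 'rV[R]_d) :
  (a *m b^T) ord0 ord0 = dotv a b.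
Proof. by rewrite mxE; apply: eq_bigr => i _; rewrite mxE. Qed.

Lemma dotvC (R : realType) (d : nat) (a b : 'rV[R]_d) : dotv a b = dotv b a.
Proof. by apply: eq_bigr => i _; rewrite mulrC. Qed.

Lemma dotvBl (R : realType) (d : nat) (a b c : 'rV[R]_d) :
  dotv (a - b) c = dotv a c - dotv b c.
Proof. by rewrite -sumrB; apply: eq_bigr => i _; rewrite !mxE mulrBl. Qed.

Lemma dotvv_ge0 (R : realType) (d : nat) (a : 'rV[R]_d) : 0 <= dotv a a.
Proof. by apply: sumr_ge0 => i _; rewrite -expr2 sqr_ge0. Qed.

Lemma dotvv_ball (R : realType) (d : nat) (a : 'rV[R]_d) :
  in_unit_ball a -> dotv a a <= 1.
Proof. by apply: le_trans; apply: ler_sum => i _; rewrite expr2. Qed.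

Lemma dotv_AMGM (R : realType) (d : nat) (k : R) (a b : 'rV[R]_d) :
  2 * k * dotv a b <= k ^+ 2 * dotv a a + dotv b b.
Proof.
rewrite /dotv !mulr_sumr -big_split /=; apply: ler_sum => i _.
have := sqr_ge0 (k * a ord0 i - b ord0 i); nra.
Qed.

Lemma dotv_le1 (R : realType) (d : nat) (a b : 'rV[R]_d) :
  in_unit_ball a -> in_unit_ball b -> `|dotv a b| <= 1.
Proof.
move=> /dotvv_ball ha /dotvv_ball hb; rewrite ler_norml.
have := dotv_AMGM 1 a b; have := dotv_AMGM (-1) a b; lra.
Qed.

Lemma ball_coord (R : realType) (d : nat) (a : 'rV[R]_d) i :
  in_unit_ball a -> `|a ord0 i| <= 1.
Proof.
move=> ha; rewrite -(@expr_le1 _ 2) // -normrX ger0_norm ?sqr_ge0 //.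
apply: le_trans ha; rewrite (bigD1 i) //= lerDl sumr_ge0 // => j _.
exact: sqr_ge0.
Qed.

(** Both sides are the determinant of the bordered matrix [M]: its lower left block can be cleared
    by a row operation, leaving [A + c *: (x^T *m x)], or by a column operation, leaving the scalar
    [1 + c * qform (invmx A) x] and [A]. *)
Lemma det_rank1 (R : realType) (d : nat) (A : 'M[R]_d) (c : R) (x : 'rV[R]_d) :
  A \in unitmx ->
  \det (A + c *: (x^T *m x)) = \det A * (1 + c * qform (invmx A) x).
Proof.
move=> uA.
pose M : 'M[R]_(1 + d) := block_mx 1%:M x (- c *: x^T) A.
have e1 : \det M = \det (A + c *: (x^T *m x)).
  have <- : \det (block_mx 1%:M 0 (c *: x^T) 1%:M *m M) = \det M.
    by rewrite det_mulmx det_lblock !det1 !mul1r.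
  rewrite /M mulmx_block !mul1mx !mul0mx !addr0 mulmx1 scaleNr addrN.
  by rewrite det_ublock det1 mul1r -scalemxAl addrC.
have e2 : \det M = \det A * (1 + c * qform (invmx A) x).
  have <- : \det (M *m block_mx 1%:M 0 (c *: (invmx A *m x^T)) 1%:M) = \det M.
    by rewrite det_mulmx det_lblock !det1 !mulr1.
  rewrite /M mulmx_block !mulmx1 !mulmx0 !add0r.
  rewrite -!scalemxAr !mulmxA mulmxV // mul1mx.
  rewrite scaleNr addNr det_ublock mulrC; congr (_ * _).
  rewrite (_ : 1%:M + _ = (1 + c * qform (invmx A) x)%:M) ?det_scalar1 //.
  by apply/matrixP => i j; rewrite !ord1 /qform !mxE mulr1n.
by rewrite -e1 e2.
Qed.

Definition pd_ge (R : realType) (d : nat) (c : R) (A : 'M[R]_d) :=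
  forall v : 'rV[R]_d, c * dotv v v <= qform A v.

Lemma qformDr1 (R : realType) (d : nat) (A : 'M[R]_d) c (x v : 'rV[R]_d) :
  qform (A + c *: (x^T *m x)) v = qform A v + c * dotv v x ^+ 2.
Proof.
rewrite /qform mulmxDr mulmxDl mxE; congr (_ + _).
rewrite -scalemxAr -scalemxAl mxE !mulmxA; congr (_ * _).
rewrite [v *m x^T]mx11_scalar mul_scalar_mx -scalemxAl mxE !mulmx_trE.
by rewrite (dotvC x) expr2.
Qed.

Lemma dotvv_eq0 (R : realType) (d : nat) (v : 'rV[R]_d) : dotv v v <= 0 -> v = 0.
Proof.
move=> h; have /eqP : dotv v v = 0 by apply/eqP; rewrite eq_le h dotvv_ge0.
rewrite psumr_eq0 => [/allP h0|i _]; last by rewrite -expr2 sqr_ge0.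
apply/rowP => i; rewrite mxE; apply/eqP.
by have := h0 i (mem_index_enum i); rewrite mulf_eq0 orbb.
Qed.

Lemma pd_unit (R : realType) (d : nat) (c : R) (A : 'M[R]_d) :
  0 < c -> pd_ge c A -> A \in unitmx.
Proof.
move=> c0 pA; rewrite -row_free_unit; apply: inj_row_free => v vA.
apply: dotvv_eq0; have := pA v; rewrite /qform vA mul0mx mxE.
by rewrite pmulr_rle0.
Qed.

Lemma pd_ge_rank1 (R : realType) (d : nat) (c k : R) (A : 'M[R]_d) (x : 'rV[R]_d) :
  0 <= k -> pd_ge c A -> pd_ge c (A + k *: (x^T *m x)).
Proof.
move=> k0 pA v; rewrite qformDr1; apply: (le_trans (pA v)).
by rewrite lerDl mulr_ge0 // sqr_ge0.
Qed.

Lemma qform_inv (R : realType) (d : nat) (A : 'M[R]_d) (x : 'rV[R]_d) :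
  A \in unitmx -> A^T = A ->
  qform (invmx A) x = qform A (x *m invmx A).
Proof.
move=> uA sA; rewrite /qform mulmxKV // trmx_mul trmx_inv sA.
by rewrite mulmxA.
Qed.

Lemma qform_inv_ge0 (R : realType) (d : nat) (c : R) (A : 'M[R]_d) (x : 'rV[R]_d) :
  0 < c -> pd_ge c A -> A^T = A -> 0 <= qform (invmx A) x.
Proof.
move=> c0 pA sA; rewrite qform_inv ?(pd_unit c0 pA) //.
by apply: le_trans (pA _); rewrite mulr_ge0 ?dotvv_ge0 ?ltW.
Qed.

(** With [z = x *m invmx A] the form is [dotv z x = qform A z], which is at least [c * dotv z z];
    the AM-GM inequality for [dotv z x] then closes the loop. With [c = 16] this bounds the Newton
    step. *)
Lemma qform_inv_le (R : realType) (d : nat) (c : R) (A : 'M[R]_d) (x : 'rV[R]_d) :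
  0 < c -> pd_ge c A -> A^T = A -> c * qform (invmx A) x <= dotv x x.
Proof.
move=> c0 pA sA; have := pA (x *m invmx A).
rewrite -qform_inv ?(pd_unit c0 pA) //.
have -> : qform (invmx A) x = dotv (x *m invmx A) x by rewrite /qform mulmx_trE.
have := dotv_AMGM c (x *m invmx A) x; set z := dotv _ x; set w := dotv _ _.
move=> h1 h2; have h3 : c * (c * w) <= c * z by rewrite ler_pM2l.
nra.
Qed.

Lemma symmx_rank1 (R : realType) (d : nat) (A : 'M[R]_d) k (x : 'rV[R]_d) :
  A^T = A -> (A + k *: (x^T *m x))^T = A + k *: (x^T *m x).
Proof. by move=> sA; rewrite linearD linearZ /= sA trmx_mul trmxK. Qed.

Lemma det_rank1_gt0 (R : realType) (d : nat) (c k : R) (A : 'M[R]_d) (x : 'rV[R]_d) :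
  0 < c -> 0 <= k -> pd_ge c A -> A^T = A -> 0 < \det A ->
  0 < \det (A + k *: (x^T *m x)).
Proof.
move=> c0 k0 pA sA dA; rewrite det_rank1 ?(pd_unit c0 pA) // mulr_gt0 //.
by rewrite ltr_pwDl // mulr_ge0 // (qform_inv_ge0 _ c0).
Qed.

(* The summand of the elliptical potential telescopes through [ln (\det _)],
   because removing [k *: x^T x] from [A'] multiplies its determinant by
   [1 - k * qform (invmx A') x]. *)
Lemma elliptical_step (R : realType) (d : nat) (c k : R) (A : 'M[R]_d) (x : 'rV[R]_d) :
  0 < c -> 0 <= k -> pd_ge c A -> A^T = A -> 0 < \det A ->
  k * qform (invmx (A + k *: (x^T *m x))) x
    <= ln (\det (A + k *: (x^T *m x))) - ln (\det A).
Proof.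
move=> c0 k0 pA sA dA; set A' := A + _.
have pA' : pd_ge c A' by exact: pd_ge_rank1.
have dA' : 0 < \det A' by exact: (det_rank1_gt0 _ c0).
have eA : A = A' + (- k) *: (x^T *m x) by rewrite /A' scaleNr addrK.
have := det_rank1 (- k) x (pd_unit c0 pA'); rewrite -eA mulNr => eD.
set y := k * _ in eD *.
have y1 : 0 < 1 - y.
  by rewrite -(pmulr_rgt0 _ dA') -eD.
rewrite eD lnM ?posrE // opprD addrA subrr add0r.
have : ln (1 - y) <= - y by apply: le_ln1Dx; rewrite ltrNl opprK; lra.
lra.
Qed.

(** Leibniz expansion. The crude factorial adds only [d ln T] to the logarithm when [d <= T]. *)
Lemma det_le (R : realType) (d : nat) (b : R) (A : 'M[R]_d) :
  (forall i j, `|A i j| <= b) -> \det A <= d`!%:R * b ^+ d.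
Proof.
move=> hA.
apply: (@le_trans _ _ (\sum_(s : 'S_d) b ^+ d)).
  apply: ler_sum => s _; apply: (le_trans (ler_norm _)).
  rewrite normrM normrX normrN1 expr1n mul1r normr_prod.
  rewrite -[X in b ^+ X]card_ord -prodr_const.
  by apply: ler_prod => i _; rewrite normr_ge0 hA.
by rewrite sumr_const card_Sn mulr_natl.
Qed.

(** * The bidding algorithm *)

Section Algorithm.
Variables (R : realType) (d T : nat).

(** The first component is the grid cell of the HOB, [None] after a loss; the second is the rounded
    realized outcome. *)
Definition outcome := (option 'I_T.+1 * 'I_T.+1)%type.
(** The offset makes the largest width exceed 2, hence any distance between [tau] and a clamped
    prediction. *)
Definition nscale : nat := (trunc_log 2 T).+4.
Definition action := option ('I_nscale * bool).
Definition state := (seq outcome * 'M[R]_d * 'rV[R]_d)%type.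

Definition gpt (j : nat) : R := j%:R / T%:R.
Definition seen (o : outcome) (lo hi : nat) : bool :=
  if o.1 is Some c then (lo < c <= hi)%N else false.
Definition level (o : outcome) : R := (o.2 : nat)%:R / T%:R.

Definition nexp : nat := (Num.trunc (Num.sqrt (T%:R : R))).+1.
(** The factor 7 makes the failure cost [4 T (T + 1)^2 / T^7] at most 1 for every [T >= 2]. *)
Definition logB : R := 7 * ln T%:R.
Definition hits (l : seq outcome) (lo hi : nat) : nat :=
  count (fun o => seen o lo hi) l.
(* The factor [1/4] makes [ghat] a lower bound for the mass of [(lo, hi]] on the
   event where [hits] is close to its mean. *)
Definition ghat (l : seq outcome) (lo hi : nat) : R :=
  if 4 * logB <= (hits l lo hi)%:R then (hits l lo hi)%:R / (4 * nexp%:R) else 0.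
Definition eps : R := Num.sqrt (d%:R / T%:R).

Definition clamp (u : R) : R := Num.max (- 1) (Num.min 1 u).
(* The prediction [u], clamped to [-1, 1], is rounded to [(pos u - T) / T].  The
   truncated subtractions below then clip the bids to [0, 1]. *)
Definition pos (u : R) : nat := Num.trunc (T%:R * (clamp u + 1)).
Definition lo_idx (j k : nat) : nat := minn T (j - (2 ^ k + T))%N.
Definition hi_idx (j k : nat) : nat := minn T (j + 2 ^ k - T)%N.
Definition mid_idx (j : nat) : nat := minn T (j - T)%N.
Definition width (k : nat) : R := (2 ^ k)%N%:R / T%:R.

Definition est (l : seq outcome) (j k : nat) : R :=
  ghat l (lo_idx j k) (hi_idx j k).
(* When [est] vanishes, division by [0] makes [xprob] vanish as well. *)
Definition xprob (l : seq outcome) (j k : nat) : R :=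
  Num.min 1 (eps / (width k * est l j k)).
Definition curv (l : seq outcome) (j : nat) : R :=
  \sum_(k < nscale) xprob l j k / nscale%:R * est l j k ^+ 2.
Definition aprob (l : seq outcome) (j : nat) (a : 'I_nscale * bool) : R :=
  xprob l j a.1 / nscale%:R / 2.

Definition bid_idx (st : state) (x : 'rV[R]_d) (a : action) : nat :=
  if (size st.1.1 < nexp)%N then T else
  let j := pos (dotv st.2 x) in
  if a is Some (k, b) then (if b then hi_idx j k else lo_idx j k)
  else mid_idx j.

(* The two bids of a probe are equally likely, so that the mean of [innov] over a
   probe at scale [k] is [est * g * (u - tau)] up to the rounding of outcomes. *)
Definition innov (l : seq outcome) (u : R) (a : action) (o : outcome) : R :=
  let j := pos u in
  if a is Some (k, b) then
    2 * est l j k *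
    (if b then (seen o (lo_idx j k) (hi_idx j k))%:R * u - level o else level o)
  else 0.

Definition upd (st : state) (x : 'rV[R]_d) (a : action) (o : outcome) : state :=
  let: (l, A, th) := st in
  if (size l < nexp)%N then (rcons l o, A, th) else
  let u := dotv th x in
  let A' := A + curv l (pos u) *: (x^T *m x) in
  (l, A', th - innov l u a o *: (x *m invmx A')).

Definition st0 : state := ([::], 16%:M, 0).

End Algorithm.

(** * Grid indices, widths and probe probabilities *)

Section Index.
Variable T : nat.

Lemma lo_le_mid j k : (lo_idx T j k <= mid_idx T j)%N.
Proof. by rewrite /lo_idx /mid_idx; lia. Qed.
Lemma mid_le_hi j k : (mid_idx T j <= hi_idx T j k)%N.
Proof. by rewrite /hi_idx /mid_idx; lia. Qed.
Lemma lo_idx_anti j k k' : (k <= k')%N -> (lo_idx T j k' <= lo_idx T j k)%N.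
Proof.
by move=> h; have := @leq_pexp2l 2 _ _ isT h; rewrite /lo_idx; lia.
Qed.
Lemma hi_idx_mono j k k' : (k <= k')%N -> (hi_idx T j k <= hi_idx T j k')%N.
Proof.
by move=> h; have := @leq_pexp2l 2 _ _ isT h; rewrite /hi_idx; lia.
Qed.
Lemma hi_idx_le j k : (hi_idx T j k <= T)%N. Proof. exact: geq_minl. Qed.
Lemma lo_idx_le j k : (lo_idx T j k <= T)%N. Proof. exact: geq_minl. Qed.
Lemma lo_le_hi j k : (lo_idx T j k <= hi_idx T j k)%N.
Proof. exact: leq_trans (lo_le_mid j k) (mid_le_hi j k). Qed.

End Index.

Section Facts.
Variables (R : realType) (d T : nat).
Hypothesis T2 : (2 <= T)%N.

Lemma T_gt0 : 0 < T%:R :> R. Proof. by rewrite ltr0n; lia. Qed.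

Definition clip01 (y : R) : R := Num.max 0 (Num.min 1 y).

(** On indices, truncated subtraction followed by [minn T] is what [clip01] is on bids. *)
Lemma gpt_clip (a b : nat) :
  gpt R T (minn T (a - b)) = clip01 ((a%:R - b%:R) / T%:R).
Proof.
have T0 := T_gt0; rewrite /gpt /clip01.
have [ab|ba] := leqP a b.
  rewrite (_ : minn _ _ = 0%N) ?mul0r; last by lia.
  rewrite (@min_r _ _ 1); last first.
    by rewrite ler_pdivrMr // mul1r lerBlDr -natrD ler_nat; lia.
  by rewrite max_l // ler_pdivrMr // mul0r subr_le0 ler_nat.
have [h|h] := leqP T (a - b).
  rewrite divff ?gt_eqF // min_l ?max_r //.
  by rewrite ler_pdivlMr // mul1r lerBrDr -natrD ler_nat; lia.
rewrite natrB; last exact: ltnW.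
rewrite min_r; last first.
  by rewrite ler_pdivrMr // mul1r lerBlDr -natrD ler_nat; lia.
by rewrite max_r // divr_ge0 ?ler0n // subr_ge0 ler_nat ltnW.
Qed.

Lemma clip01_mono (x y : R) : x <= y -> clip01 x <= clip01 y.
Proof.
move=> xy; rewrite /clip01 ge_max le_max lexx /= le_max le_min !ge_min lexx xy.
by rewrite /= !orbT.
Qed.

Lemma clamp_itv (u : R) : -1 <= clamp u <= 1.
Proof. by rewrite /clamp le_max lexx ge_max ge_min lexx; lra. Qed.

Lemma clamp_dist (u t : R) : -1 <= t <= 1 -> `|t - clamp u| <= `|t - u|.
Proof.
move=> /andP[t1 t2]; have n1 := ler_norm (t - u).
have n2 : - (t - u) <= `|t - u| by rewrite -normrN ler_norm.
rewrite /clamp ler_norml; have [h|h] := leP 1 u.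
  by rewrite max_r; [apply/andP; split; lra|lra].
by have [h'|h'] := leP (- 1) u; apply/andP; split; lra.
Qed.

Lemma pos_itv (u : R) :
  (pos T u)%:R <= T%:R * (clamp u + 1) < (pos T u)%:R + 1.
Proof.
have T0 := T_gt0.
rewrite [X in _ < X]natr1; apply: truncn_itv.
by rewrite mulr_ge0 //; have := clamp_itv u; lra.
Qed.

Definition btilde (u : R) : R := ((pos T u)%:R - T%:R) / T%:R.

Lemma btilde_clamp (u : R) : clamp u - T%:R^-1 <= btilde u <= clamp u.
Proof.
have T0 := T_gt0; have /andP[h1 h2] := pos_itv u.
rewrite /btilde ler_pdivrMr // ler_pdivlMr // mulrBl mulVf ?gt_eqF //.
by apply/andP; split; nra.
Qed.

Lemma btilde_ge (u : R) : -1 <= btilde u.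
Proof.
have T0 := T_gt0; rewrite /btilde ler_pdivlMr //.
have : 0 <= (pos T u)%:R :> R by []. lra.
Qed.

Lemma gpt_lo (u : R) k : gpt R T (lo_idx T (pos T u) k) = clip01 (btilde u - width R T k).
Proof.
rewrite gpt_clip /btilde /width -mulrBl natrD; congr (clip01 (_ / _)); lra.
Qed.

Lemma gpt_hi (u : R) k : gpt R T (hi_idx T (pos T u) k) = clip01 (btilde u + width R T k).
Proof.
rewrite gpt_clip /btilde /width -mulrDl natrD; congr (clip01 (_ / _)); lra.
Qed.

Lemma gpt_mid (u : R) : gpt R T (mid_idx T (pos T u)) = clip01 (btilde u).
Proof. by rewrite gpt_clip. Qed.

Lemma width_gt0 k : 0 < width R T k.
Proof. by rewrite divr_gt0 ?T_gt0 // ltr0n expn_gt0. Qed.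

Lemma width_mono k k' : (k <= k')%N -> width R T k <= width R T k'.
Proof.
move=> h; rewrite ler_pM2r ?invr_gt0 ?T_gt0 // ler_nat.
exact: leq_pexp2l.
Qed.

Lemma widthS k : width R T k.+1 = 2 * width R T k.
Proof. by rewrite /width expnS natrM mulrA. Qed.

(** The least scale covering [e]: by minimality the scale below it, if any, has width less than
    [e]. *)
Lemma scale_ex (e : R) : e <= 2 ->
  exists2 k : 'I_(nscale T), e <= width R T k &
    (nat_of_ord k = 0%N \/ width R T k <= 2 * e).
Proof.
move=> e2.
have T0 := T_gt0.
have eK : e <= width R T (nscale T).-1.
  apply: (le_trans e2); rewrite /width ler_pdivlMr // -natrM ler_nat /nscale /=.
  have := @trunc_log_ltn 2 T isT; rewrite !expnS; lia.
have ex : exists k, e <= width R T k by exists (nscale T).-1.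
case: (ex_minnP ex) => k ek kmin.
have kK : (k < nscale T)%N by have := kmin _ eK.
exists (Ordinal kK) => //=.
case: k ek kmin {kK} => [|k] ek kmin; [by left|right].
rewrite widthS ler_pM2l //; rewrite leNgt; apply/negP => h.
by have := kmin k (ltW h); rewrite ltnn.
Qed.

Hypothesis d0 : (0 < d)%N.

Lemma eps_gt0 : 0 < eps R d T.
Proof. by rewrite sqrtr_gt0 divr_gt0 ?T_gt0 // ltr0n. Qed.

Lemma logB_gt0 : 0 < logB R T.
Proof. by rewrite mulr_gt0 // ln_gt0 // ltr1n. Qed.

Lemma nexp_gt0 : 0 < (nexp R T)%:R :> R. Proof. by rewrite ltr0n. Qed.

Lemma ghat_ge0 (l : seq (outcome T)) lo hi : 0 <= ghat R l lo hi.
Proof. by rewrite /ghat; case: ifP => // _; rewrite divr_ge0 // mulr_ge0. Qed.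

Lemma xprob_ge0 (l : seq (outcome T)) j k : 0 <= xprob R d l j k.
Proof.
rewrite /xprob le_min ler01 divr_ge0 ?(ltW eps_gt0) //.
by rewrite mulr_ge0 ?ghat_ge0 // ltW // width_gt0.
Qed.

Lemma xprob_le1 (l : seq (outcome T)) j k : xprob R d l j k <= 1.
Proof. by rewrite /xprob ge_min lexx. Qed.

Lemma sum_xprob_le1 (l : seq (outcome T)) j :
  \sum_(k < nscale T) xprob R d l j k / (nscale T)%:R <= 1.
Proof.
rewrite -mulr_suml ler_pdivrMr ?ltr0n // mul1r.
apply: (@le_trans _ _ (\sum_(k < nscale T) 1)).
  by apply: ler_sum => k _; exact: xprob_le1.
by rewrite sumr_const card_ord.
Qed.

End Facts.

Lemma qformB (R : realType) (d : nat) (A : 'M[R]_d) (a b : 'rV[R]_d) :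
  A^T = A ->
  qform A (a - b) = qform A a - 2 * (a *m A *m b^T) ord0 ord0 + qform A b.
Proof.
move=> sA; rewrite /qform linearB /= !mulmxBl !mulmxBr.
have -> : b *m A *m a^T = (a *m A *m b^T)^T.
  by rewrite !trmx_mul trmxK sA mulmxA.
rewrite !mxE; ring.
Qed.

(** The step direction carries the inverse of the updated matrix, so the cross term of the expanded
    square reduces to [dotv v x]. *)
Lemma qform_newton (R : realType) (d : nat) (A : 'M[R]_d) (k h : R)
    (x v : 'rV[R]_d) :
  A^T = A -> A + k *: (x^T *m x) \in unitmx ->
  qform (A + k *: (x^T *m x))
    (v - h *: (x *m invmx (A + k *: (x^T *m x)))) =
  qform A v + k * dotv v x ^+ 2 - 2 * h * dotv v x
  + h ^+ 2 * qform (invmx (A + k *: (x^T *m x))) x.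
Proof.
move=> sA; rewrite -qformDr1; have := symmx_rank1 k x sA.
set A' := A + _ => sA' uA'.
rewrite qformB // [(_ *: _)^T]linearZ /= -scalemxAr mxE.
rewrite trmx_mul trmx_inv sA' mulmxA mulmxK // mulmx_trE.
have -> : qform A' (h *: (x *m invmx A')) = h ^+ 2 * qform (invmx A') x.
  rewrite qform_inv // /qform linearZ /= -!scalemxAl -scalemxAr !mxE expr2 mulrA.
  by rewrite -mulrA.
ring.
Qed.

(** * Regret in a finite environment *)

(* [G i] is the cdf of the HOB at the grid point [i / T], [ker t b] the law of the
   rounded observation in round [t] after bidding [b / T], and [reg t b] the
   regret of that bid. *)
Record environment (R : realType) (d T : nat) (theta : 'rV[R]_d)
    (x : nat -> 'rV[R]_d) (G mu : nat -> R) (ker : nat -> nat -> outcome T -> R)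
    (reg : nat -> nat -> R) : Prop := Environment {
  env_T : (2 <= T)%N;
  env_d : (0 < d)%N;
  env_theta : in_unit_ball theta;
  env_x : forall t, in_unit_ball (x t);
  env_G_mono : forall i j, (i <= j <= T)%N -> G i <= G j;
  env_G_itv : forall i, (i <= T)%N -> 0 <= G i <= 1;
  env_ker_ge0 : forall t b o, 0 <= ker t b o;
  env_ker_sum1 : forall t b, (b <= T)%N -> \sum_o ker t b o = 1;
  env_ker_level : forall t b, (b <= T)%N ->
    G b * dotv theta (x t) + mu t - T%:R^-1 <= \sum_o ker t b o * level R o
      <= G b * dotv theta (x t) + mu t;
  env_ker_seen : forall t b lo hi, (lo <= hi)%N -> (hi <= b <= T)%N ->
    \sum_o ker t b o * (seen o lo hi)%:R = G hi - G lo;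
  env_reg_le : forall t y lo b hi,
    (lo <= b <= hi)%N -> (hi <= T)%N -> gpt R T b = clip01 y ->
    gpt R T lo <= clip01 (dotv theta (x t)) <= gpt R T hi ->
    reg t b <= `|dotv theta (x t) - y| * (G hi - G lo)
}.

Section Environment.
Variables (R : realType) (d T : nat).
Variables (theta : 'rV[R]_d) (x : nat -> 'rV[R]_d).
Variables (G : nat -> R) (mu : nat -> R).
Variable ker : nat -> nat -> outcome T -> R.
Variable reg : nat -> nat -> R.
Hypothesis env : environment theta x G mu ker reg.
Local Notation tau t := (dotv theta (x t)).

Let T2 := env_T env.
Let d0 := env_d env.
Let theta1 := env_theta env.
Let x1 := env_x env.
Let G_mono := env_G_mono env.
Let G_itv := env_G_itv env.
Let ker_ge0 := env_ker_ge0 env.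
Let ker_sum1 := env_ker_sum1 env.
Let ker_level := env_ker_level env.
Let ker_seen := env_ker_seen env.
Let reg_le := env_reg_le env.

(** Expectation over the drawn action and the outcome of its bid, written as a finite sum so that
    the regret analysis is free of measure theory; [step_sum] links it to the actual draw. *)
Definition step (t : nat) (l : seq (outcome T)) (j : nat)
    (b : action T -> nat) (F : action T -> outcome T -> R) : R :=
  (1 - \sum_(k < nscale T) xprob R d l j k / (nscale T)%:R)
    * (\sum_o ker t (b None) o * F None o)
  + \sum_(k < nscale T) xprob R d l j k / (nscale T)%:R *
      ((\sum_o ker t (b (Some (k, false))) o * F (Some (k, false)) o
       + \sum_o ker t (b (Some (k, true))) o * F (Some (k, true)) o) / 2).

(* Expected regret of the [r] rounds starting with round [t] in state [st]. *)
Fixpoint rtg (r t : nat) (st : state R d T) : R :=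
  if r is r'.+1 then
    step t st.1.1 (pos T (dotv st.2 (x t))) (bid_idx st (x t))
      (fun a o => reg t (bid_idx st (x t) a) + rtg r' t.+1 (upd st (x t) a o))
  else 0.

Section Step.
Variables (t : nat) (l : seq (outcome T)) (j : nat) (b : action T -> nat).
Hypothesis bT : forall a, (b a <= T)%N.

Let q_ge0 (k : nat) : 0 <= xprob R d l j k / (nscale T)%:R.
Proof. by rewrite divr_ge0 ?xprob_ge0. Qed.

Let q_None : 0 <= 1 - \sum_(k < nscale T) xprob R d l j k / (nscale T)%:R.
Proof. by rewrite subr_ge0; apply: sum_xprob_le1. Qed.

Lemma step_le F F' : (forall a o, F a o <= F' a o) ->
  step t l j b F <= step t l j b F'.
Proof.
move=> h; apply: lerD.
  by apply: ler_wpM2l => //; apply: ler_sum => o _; apply: ler_wpM2l.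
apply: ler_sum => k _; apply: ler_wpM2l => //; rewrite ler_pM2r ?invr_gt0 //.
by apply: lerD; apply: ler_sum => o _; apply: ler_wpM2l.
Qed.

Lemma stepD F F' :
  step t l j b (fun a o => F a o + F' a o) = step t l j b F + step t l j b F'.
Proof.
rewrite /step.
have e a : \sum_o ker t (b a) o * (F a o + F' a o) =
    \sum_o ker t (b a) o * F a o + \sum_o ker t (b a) o * F' a o.
  by rewrite -big_split; apply: eq_bigr => o _; rewrite mulrDr.
rewrite e mulrDr addrACA -big_split; congr (_ + _).
by apply: eq_bigr => k _; rewrite !e /=; ring.
Qed.

Lemma stepZ c F :
  step t l j b (fun a o => c * F a o) = c * step t l j b F.
Proof.
rewrite /step.
have e a : \sum_o ker t (b a) o * (c * F a o) = c * \sum_o ker t (b a) o * F a o.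
  by rewrite mulr_sumr; apply: eq_bigr => o _; rewrite mulrCA.
rewrite e [RHS]mulrDr mulrCA; congr (_ + _); rewrite [RHS]mulr_sumr.
by apply: eq_bigr => k _; rewrite !e /=; ring.
Qed.

Lemma step_act f : step t l j b (fun a o => f a) =
  (1 - \sum_(k < nscale T) xprob R d l j k / (nscale T)%:R) * f None
  + \sum_(k < nscale T) xprob R d l j k / (nscale T)%:R *
      ((f (Some (k, false)) + f (Some (k, true))) / 2).
Proof.
have e a : \sum_o ker t (b a) o * f a = f a by rewrite -mulr_suml ker_sum1 // mul1r.
by rewrite /step e; congr (_ + _); apply: eq_bigr => k _; rewrite !e.
Qed.

Lemma step_cst c : step t l j b (fun a o => c) = c.
Proof.
rewrite step_act; set S := \sum_(k < _) _.
suff -> : \sum_(k < nscale T) xprob R d l j k / (nscale T)%:R * ((c + c) / 2) = S * c.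
  by ring.
by rewrite mulr_suml; apply: eq_bigr => k _; congr (_ * _); field.
Qed.

End Step.

Definition mass (lo hi : nat) : R := G hi - G lo.

(* The estimates in [l] are within a constant factor of the masses of all grid
   intervals that are not negligible. *)
Definition accurate (l : seq (outcome T)) : Prop :=
  forall lo hi : nat, (lo <= hi <= T)%N ->
  [/\ ghat R l lo hi <= mass lo hi,
      0 < ghat R l lo hi -> mass lo hi <= 12 * ghat R l lo hi &
      ghat R l lo hi = 0 -> mass lo hi <= 10 * logB R T / (nexp R T)%:R].

Lemma mass_ge0 lo hi : (lo <= hi <= T)%N -> 0 <= mass lo hi.
Proof. by move=> h; rewrite subr_ge0 G_mono. Qed.

Lemma mass_le1 lo hi : (lo <= hi <= T)%N -> mass lo hi <= 1.
Proof.
move=> /andP[h1 h2]; have := G_itv h2; have := G_itv (leq_trans h1 h2).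
rewrite /mass; lra.
Qed.

Lemma tau_itv t : -1 <= tau t <= 1.
Proof. by rewrite -ler_norml dotv_le1. Qed.

(** * One round after exploration *)

Section Round.
Variables (t : nat) (l : seq (outcome T)) (A : 'M[R]_d) (th : 'rV[R]_d).
Hypothesis size_l : (nexp R T <= size l)%N.
Hypothesis acc_l : accurate l.

Let st : state R d T := (l, A, th).
Let u := dotv th (x t).
Let j := pos T u.
Let s := u - tau t.
Let g (k : nat) := mass (lo_idx T j k) (hi_idx T j k).
Let c (k : nat) := est R l j k.
Let p (k : nat) := xprob R d l j k.
Let q (k : nat) := p k / (nscale T)%:R.
Let w (k : nat) := width R T k.
(** Up to rounding, [info * s] is the mean of [innov]; hence [info * s ^+ 2] measures the mean
    progress of the round. It differs from [curv] in that one estimate is replaced by the true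
    mass. *)
Let info := \sum_(k < nscale T) q k * (c k * g k).

Let lohi k : (lo_idx T j k <= hi_idx T j k <= T)%N.
Proof. by rewrite lo_le_hi hi_idx_le. Qed.

Let c_ge0 k : 0 <= c k. Proof. exact: ghat_ge0. Qed.
Let c_le_g k : c k <= g k. Proof. by case: (acc_l (lohi k)). Qed.
Let g_le1 k : g k <= 1. Proof. exact: mass_le1. Qed.
Let g_ge0 k : 0 <= g k. Proof. exact: mass_ge0. Qed.
Let q_ge0 k : 0 <= q k. Proof. by rewrite divr_ge0 // xprob_ge0. Qed.
Let sum_q : \sum_(k < nscale T) q k <= 1. Proof. exact: sum_xprob_le1. Qed.
Let T0 : 0 < T%:R :> R. Proof. exact: T_gt0. Qed.
Let w_gt0 k : 0 < w k. Proof. exact: width_gt0. Qed.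
Let bidT a : (bid_idx st (x t) a <= T)%N.
Proof.
rewrite /bid_idx ltnNge size_l /=; case: a => [[k []]|]; exact: geq_minl.
Qed.

Lemma curv_ge0 : 0 <= curv R d l j.
Proof. by apply: sumr_ge0 => k _; rewrite mulr_ge0 ?sqr_ge0 // -/(p k) q_ge0. Qed.

Lemma curv_le_info : curv R d l j <= info.
Proof.
apply: ler_sum => k _; rewrite ler_wpM2l ?q_ge0 // expr2.
by rewrite ler_wpM2l ?c_ge0 // c_le_g.
Qed.

Lemma info_le1 : info <= 1.
Proof.
apply: le_trans sum_q; apply: ler_sum => k _.
rewrite -[leRHS]mulr1 ler_wpM2l // -[leRHS]mulr1.
by apply: ler_pM => //; apply: le_trans (g_le1 k).
Qed.

Lemma curv_le1 : curv R d l j <= 1.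
Proof. exact: le_trans curv_le_info info_le1. Qed.

Lemma info_ge0 : 0 <= info.
Proof. exact: le_trans curv_ge0 curv_le_info. Qed.

Let K0 : 0 < (nscale T)%:R :> R. Proof. by rewrite ltr0n. Qed.
Let N0 : 0 < (nexp R T)%:R :> R. Proof. exact: nexp_gt0. Qed.
Let e0 : 0 < eps R d T. Proof. exact: eps_gt0. Qed.
Let B0 : 0 < logB R T. Proof. exact: logB_gt0. Qed.
Let e : R := `|tau t - btilde T u|.

(** If the estimate vanishes, so does the probe probability. Otherwise that probability is at most
    [eps / (w k * c k)], and accuracy gives [g k <= 12 * c k]. *)
Lemma exploration_cost k : p k * (w k * g k) <= 12 * eps R d T.
Proof.
have [_ h1 _] := acc_l (lohi k).
have := c_ge0 k; rewrite le_eqVlt => /orP[/eqP ck|ck].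
  by rewrite /p /xprob -/(c k) -ck mulr0 invr0 mulr0 min_r // mul0r mulr_ge0 // ltW.
have h2 : w k * g k <= 12 * (w k * c k).
  by rewrite mulrCA ler_pM2l // h1.
have h3 : p k * (w k * c k) <= eps R d T.
  by rewrite -(ler_pdivlMr _ _ (mulr_gt0 (w_gt0 k) ck)) /p /xprob ge_min lexx orbT.
apply: (@le_trans _ _ (p k * (12 * (w k * c k)))).
  by rewrite ler_wpM2l // xprob_ge0.
by rewrite mulrCA ler_pM2l.
Qed.

Lemma btilde_err_sq : e ^+ 2 <= 2 * s ^+ 2 + 2 / T%:R ^+ 2.
Proof.
have /andP[b1 b2] := btilde_clamp T2 u.
have hd := clamp_dist u (tau_itv t).
have h : e <= `|s| + T%:R^-1.
  rewrite /e.
  have -> : tau t - btilde T u = (tau t - clamp u) + (clamp u - btilde T u) by ring.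
  apply: (le_trans (ler_normD _ _)); apply: lerD; first by rewrite /s (distrC u).
  by rewrite ger0_norm; lra.
have i0 : 0 <= T%:R^-1 :> R by rewrite invr_ge0.
have en : 0 <= e by rewrite normr_ge0.
have -> : s ^+ 2 = `|s| ^+ 2 by rewrite real_normK // num_real.
have -> : 2 / T%:R ^+ 2 = 2 * (T%:R^-1) ^+ 2 :> R by rewrite exprVn.
have s0 := normr_ge0 s.
have : e ^+ 2 <= (`|s| + T%:R^-1) ^+ 2 by rewrite lerXn2r // nnegrE addr_ge0.
have := sqr_ge0 (`|s| - T%:R^-1); rewrite sqrrB sqrrD; lra.
Qed.

(** Each summand settles one case. At [k = 0] the width is [1 / T]. If the estimate is 0, the mass
    is at most [10 * logB / nexp] and the width at most [2 * e <= 4]. If [w k * c k <= eps],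
    accuracy gives [12 * eps]. Otherwise the probe probability is exactly [eps / (w k * c k)], so
    this scale alone contributes [eps / nscale * (g k / w k)] to [info], and [w k <= 2 * e] turns
    [w k * g k] into at most [4 * (g k / w k) * e ^+ 2]. *)
Lemma scale_cost (k : 'I_(nscale T)) :
  e <= w k -> (nat_of_ord k = 0%N \/ w k <= 2 * e) ->
  w k * g k <= T%:R^-1 + 40 * logB R T / (nexp R T)%:R + 12 * eps R d T
    + 8 * (nscale T)%:R / eps R d T * (info * s ^+ 2 + (T%:R ^+ 2)^-1).
Proof.
move=> ek hk.
have B1 : 0 <= logB R T := ltW B0.
have e1 : 0 <= eps R d T := ltW e0.
have i0 : 0 <= T%:R^-1 :> R by rewrite invr_ge0.
have a1 : 0 <= 40 * logB R T / (nexp R T)%:R.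
  by apply: divr_ge0 => //; apply: mulr_ge0.
have a2 : 0 <= 12 * eps R d T by apply: mulr_ge0.
have a3 : 0 <= 8 * (nscale T)%:R / eps R d T * (info * s ^+ 2 + (T%:R ^+ 2)^-1).
  apply: mulr_ge0; first by apply: divr_ge0 => //; apply: mulr_ge0.
  by rewrite addr_ge0 ?invr_ge0 ?sqr_ge0 // mulr_ge0 ?sqr_ge0 // info_ge0.
case: hk => [k0|hk].
  have -> : w k = T%:R^-1 by rewrite /w /width k0 expn0 mul1r.
  suff : T%:R^-1 * g k <= T%:R^-1 by lra.
  by rewrite -[leRHS]mulr1 ler_wpM2l.
have e2 : e <= 2.
  have /andP[b1 b2] := btilde_clamp T2 u; have b3 := btilde_ge T2 u.
  have := tau_itv t; have := clamp_itv u; rewrite /e ler_norml; lra.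
have [_ h1 h0] := acc_l (lohi k).
have := c_ge0 k; rewrite le_eqVlt => /orP[/eqP ck|ck].
  suff : w k * g k <= 40 * logB R T / (nexp R T)%:R by lra.
  have -> : 40 * logB R T / (nexp R T)%:R = 4 * (10 * logB R T / (nexp R T)%:R).
    by ring.
  apply: ler_pM => //; [exact: ltW|lra|].
  by apply: h0; exact/esym/ck.
have h2 : w k * g k <= 12 * (w k * c k) by rewrite mulrCA ler_pM2l // h1.
have wc0 : 0 < w k * c k by rewrite mulr_gt0.
have [small|large] := leP (w k * c k) (eps R d T); first by nra.
have pk : p k = eps R d T / (w k * c k).
  by rewrite /p /xprob min_r // ler_pdivrMr // mul1r ltW.
have i1 : q k * (c k * g k) <= info.
  rewrite /info (bigD1 k) //= lerDl sumr_ge0 // => i _.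
  by rewrite mulr_ge0 // mulr_ge0.
have i2 : q k * (c k * g k) = eps R d T / (nscale T)%:R * (g k / w k).
  rewrite /q pk; field.
  by rewrite !gt_eqF // -?(pmulr_rgt0 _ (w_gt0 k)).
have err := btilde_err_sq.
have h3 : w k * g k <= 4 * (nscale T)%:R / eps R d T * (info * e ^+ 2).
  have h4 : w k * g k <= 4 * (g k / w k * e ^+ 2).
    have -> : w k * g k = g k / w k * w k ^+ 2.
      by field; rewrite gt_eqF.
    rewrite [leRHS]mulrCA ler_wpM2l //; first by rewrite divr_ge0 // ltW.
    have -> : 4 * e ^+ 2 = (2 * e) ^+ 2 by ring.
    by apply: lerXn2r => //; rewrite nnegrE ?mulr_ge0 ?normr_ge0 // ltW.
  apply: (le_trans h4).
  have -> : 4 * (nscale T)%:R / eps R d T * (info * e ^+ 2) =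
            4 * (((nscale T)%:R / eps R d T * info) * e ^+ 2) by ring.
  rewrite ler_pM2l // ler_wpM2r ?sqr_ge0 //.
  move: i1; rewrite i2 => i1.
  apply: (@le_trans _ _ ((nscale T)%:R / eps R d T * (eps R d T / (nscale T)%:R * (g k / w k)))).
    rewrite le_eqVlt; apply/orP; left; apply/eqP; field.
    by rewrite !gt_eqF.
  by rewrite ler_wpM2l // divr_ge0 // ltW.
suff : 4 * (nscale T)%:R / eps R d T * (info * e ^+ 2) <=
   8 * (nscale T)%:R / eps R d T * (info * s ^+ 2 + (T%:R ^+ 2)^-1) by lra.
have -> : 8 * (nscale T)%:R / eps R d T * (info * s ^+ 2 + (T%:R ^+ 2)^-1) =
   4 * (nscale T)%:R / eps R d T * (info * (2 * s ^+ 2) + 2 / T%:R ^+ 2) by ring.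
rewrite ler_wpM2l //; first by rewrite divr_ge0 ?mulr_ge0 // ltW.
apply: (@le_trans _ _ (info * (2 * s ^+ 2 + 2 / T%:R ^+ 2))).
  by rewrite ler_wpM2l // info_ge0.
by rewrite mulrDr lerD2l -[leRHS]mul1r ler_wpM2r ?info_le1.
Qed.

(** Let [W = w ks * g ks] at the scale [ks] of the error. The plain bid costs at most [W], a probe
    at most [2 * W + 2 * w k * g k]; by [exploration_cost] the second part averages to [24 * eps].
    The total [3 * W + 24 * eps] triples the constants of [scale_cost], and [60 = 3 * 12 + 24]. *)
Lemma step_regret :
  step t l j (bid_idx st (x t)) (fun a _ => reg t (bid_idx st (x t) a)) <=
  3 / T%:R + 120 * logB R T / (nexp R T)%:R + 60 * eps R d T
    + 24 * (nscale T)%:R / eps R d T * (info * s ^+ 2 + (T%:R ^+ 2)^-1).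
Proof.
have e2 : e <= 2.
  have /andP[b1 b2] := btilde_clamp T2 u; have b3 := btilde_ge T2 u.
  have := tau_itv t; have := clamp_itv u; rewrite /e ler_norml; lra.
have [ks eks hks] := scale_ex T2 e2.
have cost := scale_cost eks hks.
have nsz : (size l < nexp R T)%N = false by rewrite ltnNge size_l.
have en1 : tau t - btilde T u <= e := ler_norm _.
have en2 : - (tau t - btilde T u) <= e by rewrite /e -normrN ler_norm.
have cover k : e <= w k ->
    gpt R T (lo_idx T j k) <= clip01 (tau t) <= gpt R T (hi_idx T j k).
  by move=> ek; rewrite gpt_lo // gpt_hi // !clip01_mono // -/(w k); lra.
have reg_mid : reg t (bid_idx st (x t) None) <= w ks * g ks.
  rewrite /bid_idx /= nsz.
  apply: (le_trans (reg_le _ _ (gpt_mid T2 u) (cover _ eks))).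
  - by rewrite lo_le_mid mid_le_hi.
  - exact: hi_idx_le.
  - exact: (ler_wpM2r (g_ge0 ks) eks).
have wg0 k : 0 <= w k * g k by rewrite mulr_ge0 // ltW.
(* A probe no wider than [ks] stays in the window of [ks]; a wider one has a window that already
   contains [tau] after clipping. In each case the distance to [tau] is at most twice the larger
   width. *)
have side y k i : (lo_idx T j k <= i <= hi_idx T j k)%N -> gpt R T i = clip01 y ->
    `|tau t - y| <= e + w k -> reg t i <= 2 * (w ks * g ks) + 2 * (w k * g k).
  move=> /andP[i1 i2] iy ty.
  have w_mono k1 k2 : (k1 <= k2)%N -> w k1 <= w k2 := @width_mono R T T2 k1 k2.
  have [kk|kk] := leqP k ks.
    apply: (le_trans (reg_le _ _ iy (cover _ eks))).
    - by rewrite (leq_trans (lo_idx_anti T j kk)) //= (leq_trans i2) // hi_idx_mono.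
    - exact: hi_idx_le.
    - rewrite -/(g ks); apply: (@le_trans _ _ (2 * (w ks * g ks))).
        rewrite mulrA ler_wpM2r ?(g_ge0 ks) // (le_trans ty) // mulr_natl mulr2n.
        exact: (lerD eks (w_mono _ _ kk)).
      by rewrite lerDl mulr_ge0.
  have ek : e <= w k by apply: le_trans eks _; exact: w_mono (ltnW kk).
  apply: (le_trans (reg_le _ _ iy (cover _ ek))); rewrite ?i1 ?hi_idx_le //.
  rewrite -/(g k); apply: (@le_trans _ _ (2 * (w k * g k))).
    rewrite mulrA ler_wpM2r ?(g_ge0 k) // (le_trans ty) // mulr_natl mulr2n.
    by rewrite lerD.
  by rewrite lerDr mulr_ge0.
have reg_lo (k : 'I_(nscale T)) : reg t (bid_idx st (x t) (Some (k, false))) <=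
    2 * (w ks * g ks) + 2 * (w k * g k).
  rewrite /bid_idx /= nsz; apply: (side _ _ _ _ (gpt_lo T2 u k)).
    by rewrite leqnn lo_le_hi.
  have -> : tau t - (btilde T u - width R T k) = (tau t - btilde T u) + w k.
    by rewrite /w; ring.
  by apply: (le_trans (ler_normD _ _)); rewrite lerD2l ger0_norm // ltW.
have reg_hi (k : 'I_(nscale T)) : reg t (bid_idx st (x t) (Some (k, true))) <=
    2 * (w ks * g ks) + 2 * (w k * g k).
  rewrite /bid_idx /= nsz; apply: (side _ _ _ _ (gpt_hi T2 u k)).
    by rewrite leqnn lo_le_hi.
  have -> : tau t - (btilde T u + width R T k) = (tau t - btilde T u) - w k.
    by rewrite /w; ring.
  by apply: (le_trans (ler_normB _ _)); rewrite lerD2l ger0_norm // ltW.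
rewrite (step_act _ _ _ bidT (fun a => reg t (bid_idx st (x t) a))).
set W := w ks * g ks in cost reg_mid reg_lo reg_hi *.
have W0 : 0 <= W := wg0 ks.
have part1 : (1 - \sum_(k < nscale T) q k) * reg t (bid_idx st (x t) None) <= W.
  apply: (@le_trans _ _ ((1 - \sum_(k < nscale T) q k) * W)).
    by rewrite ler_wpM2l // subr_ge0.
  rewrite -[leRHS]mul1r ler_wpM2r // gerBl sumr_ge0 // => k _; exact: q_ge0.
have part2 : \sum_(k < nscale T) q k *
    ((reg t (bid_idx st (x t) (Some (k, false)))
     + reg t (bid_idx st (x t) (Some (k, true)))) / 2) <= 2 * W + 24 * eps R d T.
  apply: (@le_trans _ _ (\sum_(k < nscale T)
      (q k * (2 * W) + 24 * eps R d T / (nscale T)%:R))).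
    apply: ler_sum => k _; have := reg_lo k; have := reg_hi k => r1 r2.
    apply: (@le_trans _ _ (q k * (2 * W + 2 * (w k * g k)))).
      by rewrite ler_wpM2l //; lra.
    rewrite mulrDr lerD2l /q.
    have -> : p k / (nscale T)%:R * (2 * (w k * g k)) =
              2 * (p k * (w k * g k)) / (nscale T)%:R by ring.
    rewrite ler_pM2r ?invr_gt0 //; have := exploration_cost k; lra.
  rewrite big_split /= -mulr_suml sumr_const card_ord -[(_ / _) *+ _]mulr_natr.
  rewrite divfK ?gt_eqF // lerD2r -[leRHS]mul1r ler_wpM2r // mulr_ge0 //.
rewrite -/(p _) in part1 part2 *.
have := lerD part1 part2; rewrite /q /p => h; apply: (le_trans h).
set X := info * _ + _ in cost *.
have -> : 24 * (nscale T)%:R / eps R d T * X = 3 * (8 * (nscale T)%:R / eps R d T * X).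
  by ring.
have -> : 120 * logB R T / (nexp R T)%:R = 3 * (40 * logB R T / (nexp R T)%:R) by ring.
lra.
Qed.

Lemma level_itv (o : outcome T) : 0 <= level R o <= 1.
Proof.
rewrite divr_ge0 //= ler_pdivrMr // mul1r ler_nat.
by have := ltn_ord o.2.
Qed.

Let mean_level (k : nat) := \sum_o ker t k o * level R o.

Let nsz : (size l < nexp R T)%N = false. Proof. by rewrite ltnNge size_l. Qed.

Let bid_lo (k : 'I_(nscale T)) :
  bid_idx st (x t) (Some (k, false)) = lo_idx T j k.
Proof. by rewrite /bid_idx /= nsz. Qed.

Let bid_hi (k : 'I_(nscale T)) :
  bid_idx st (x t) (Some (k, true)) = hi_idx T j k.
Proof. by rewrite /bid_idx /= nsz. Qed.

Let innov_lo (k : 'I_(nscale T)) :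
  \sum_o ker t (lo_idx T j k) o * innov l u (Some (k, false)) o
  = 2 * c k * mean_level (lo_idx T j k).
Proof. by rewrite mulr_sumr; apply: eq_bigr => o _; rewrite /innov /= mulrCA. Qed.

Let innov_hi (k : 'I_(nscale T)) :
  \sum_o ker t (hi_idx T j k) o * innov l u (Some (k, true)) o
  = 2 * c k * (g k * u - mean_level (hi_idx T j k)).
Proof.
have := ker_seen t (lo_le_hi T j k) (_ : hi_idx T j k <= hi_idx T j k <= T)%N.
rewrite leqnn hi_idx_le => /(_ isT) gE.
rewrite /g /mass -gE mulr_suml -sumrB mulr_sumr; apply: eq_bigr => o _.
by rewrite /innov /= -/(c k); ring.
Qed.

(** The unknown baseline [mu t] cancels between the two sides of a probe, leaving
    [c k * (g k * s - b)] with rounding bias [b] at most [1 / T]. AM-GM splits [2 * c k * s * b]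
    into a quarter of [c k ^+ 2 * s ^+ 2], whence [7 / 4], and [4 * b ^+ 2]. *)
Lemma step_innov :
  - 2 * s * step t l j (bid_idx st (x t)) (innov l u) <=
  - (7 / 4) * info * s ^+ 2 + 4 / T%:R ^+ 2.
Proof.
have i2 : 0 <= 4 / T%:R ^+ 2 :> R by rewrite divr_ge0 // sqr_ge0.
rewrite /step [X in _ * X + _](_ : _ = 0); last by rewrite big1 // => o _; rewrite mulr0.
rewrite mulr0 add0r mulr_sumr.
have -> : - (7 / 4) * info * s ^+ 2 =
    \sum_(k < nscale T) q k * (- (7 / 4) * (c k * g k) * s ^+ 2).
  rewrite /info mulr_sumr mulr_suml; apply: eq_bigr => k _; ring.
apply: (@le_trans _ _ (\sum_(k < nscale T) (q k * (- (7 / 4) * (c k * g k) * s ^+ 2)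
    + q k * (4 / T%:R ^+ 2)))); last first.
  rewrite big_split /= lerD2l -mulr_suml -[leRHS]mul1r ler_wpM2r //.
apply: ler_sum => k _; rewrite bid_lo bid_hi innov_lo innov_hi -[leRHS]mulrDr [leLHS]mulrCA -/(q k).
rewrite ler_wpM2l //.
set Yl := mean_level _; set Yh := mean_level _.
set b := Yh - Yl - g k * tau t.
have bT : `|b| <= T%:R^-1.
  have : G (lo_idx T j k) * tau t + mu t - T%:R^-1 <= Yl <=
      G (lo_idx T j k) * tau t + mu t by exact: ker_level (lo_idx_le T j k).
  have : G (hi_idx T j k) * tau t + mu t - T%:R^-1 <= Yh <=
      G (hi_idx T j k) * tau t + mu t by exact: ker_level (hi_idx_le T j k).
  rewrite ler_norml /b /g /mass mulrBl; clearbody Yl Yh; lra.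
have sE : s = u - tau t by [].
have -> : - 2 * s * ((2 * c k * Yl + 2 * c k * (g k * u - Yh)) / 2)
   = - 2 * (c k * g k) * s ^+ 2 + 2 * (c k * s * b).
  by rewrite /b sE; field.
have cg : c k ^+ 2 * s ^+ 2 <= c k * g k * s ^+ 2.
  by rewrite ler_wpM2r ?sqr_ge0 // expr2 ler_wpM2l.
have b2 : b ^+ 2 <= (T%:R ^+ 2)^-1.
  by rewrite -exprVn -(real_normK (num_real b)); apply: lerXn2r; rewrite ?nnegrE ?invr_ge0.
have := sqr_ge0 (c k * s / 2 - 2 * b).
have -> : (c k * s / 2 - 2 * b) ^+ 2 = c k ^+ 2 * s ^+ 2 / 4 - 2 * (c k * s * b) + 4 * b ^+ 2.
  by field.
lra.
Qed.

(** The prediction [u] is unbounded, so the upper innovation is split as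
    [D * s + (D * tau t - level)], whose second part is at most 2 in absolute value. The two sides
    of a probe give [4 * c k ^+ 2] and [32 * c k ^+ 2] plus the part in [s ^+ 2]; averaging yields
    18. *)
Lemma step_innov_sq :
  step t l j (bid_idx st (x t)) (fun a o => innov l u a o ^+ 2) <=
  18 * curv R d l j + 4 * info * s ^+ 2.
Proof.
rewrite /step [X in _ * X + _](_ : _ = 0); last first.
  by rewrite big1 // => o _; rewrite /innov expr0n mulr0.
rewrite mulr0 add0r.
have -> : 18 * curv R d l j + 4 * info * s ^+ 2 =
    \sum_(k < nscale T) q k * (18 * c k ^+ 2 + 4 * (c k * g k) * s ^+ 2).
  rewrite /info /curv !mulr_sumr mulr_suml -big_split /=.
  by apply: eq_bigr => k _; rewrite /q /p /c; ring.
apply: ler_sum => k _; rewrite bid_lo bid_hi -/(q k) ler_wpM2l //.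
have c2 : 0 <= c k ^+ 2 := sqr_ge0 _.
have lo_sq : \sum_o ker t (lo_idx T j k) o * innov l u (Some (k, false)) o ^+ 2
    <= 4 * c k ^+ 2.
  have -> : 4 * c k ^+ 2 = (\sum_o ker t (lo_idx T j k) o) * (4 * c k ^+ 2).
    by rewrite ker_sum1 ?mul1r ?lo_idx_le.
  rewrite mulr_suml.
  apply: ler_sum => o _; rewrite ler_wpM2l // /innov /= -/(c k).
  have -> : (2 * c k * level R o) ^+ 2 = 4 * c k ^+ 2 * level R o ^+ 2 by ring.
  rewrite -[leRHS]mulr1 ler_wpM2l ?mulr_ge0 //.
  by have /andP[y0 y1] := level_itv o; rewrite expr_le1.
have hi_sq : \sum_o ker t (hi_idx T j k) o * innov l u (Some (k, true)) o ^+ 2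
    <= 8 * c k ^+ 2 * (g k * s ^+ 2 + 4).
  have := ker_seen t (lo_le_hi T j k) (_ : hi_idx T j k <= hi_idx T j k <= T)%N.
  rewrite leqnn hi_idx_le => /(_ isT) gE.
  have -> : g k * s ^+ 2 + 4 = g k * s ^+ 2 + (\sum_o ker t (hi_idx T j k) o) * 4.
    by rewrite ker_sum1 ?mul1r ?hi_idx_le.
  rewrite /g /mass -gE.
  rewrite !mulr_suml -big_split mulr_sumr /=.
  apply: ler_sum => o _; rewrite /innov /= -/(c k).
  set D : R := (seen o _ _)%:R.
  have D2 : D ^+ 2 = D by rewrite /D; case: seen; rewrite ?expr1n ?expr0n.
  have D01 : 0 <= D <= 1 by rewrite /D; case: seen; rewrite ?lexx ?ler01.
  have -> : 8 * c k ^+ 2 * (ker t (hi_idx T j k) o * D * s ^+ 2 +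
     ker t (hi_idx T j k) o * 4) =
     ker t (hi_idx T j k) o * (8 * c k ^+ 2 * (D * s ^+ 2 + 4)) by ring.
  rewrite ler_wpM2l //.
  have -> : (2 * c k * (D * u - level R o)) ^+ 2 =
     4 * c k ^+ 2 * (D * s + (D * tau t - level R o)) ^+ 2 by rewrite /s; ring.
  have -> : 8 * c k ^+ 2 * (D * s ^+ 2 + 4) = 4 * c k ^+ 2 * (2 * (D * s ^+ 2 + 4)).
    by ring.
  rewrite ler_wpM2l ?mulr_ge0 //.
  have /andP[y0 y1] := level_itv o; have /andP[t0 t1] := tau_itv t.
  have z2 : (D * tau t - level R o) ^+ 2 <= 4.
    move: D01 {D2} => /andP[D0 D1].
    have z1 : -2 <= D * tau t - level R o by nra.
    have z3 : D * tau t - level R o <= 2 by nra.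
    rewrite -subr_ge0 in z1; rewrite -subr_ge0 in z3.
    have := mulr_ge0 z1 z3; lra.
  have hd : (D * s) ^+ 2 = D * s ^+ 2 by rewrite exprMn D2.
  move: z2; move: (D * tau t - level R o) => z z2.
  have -> : (D * s + z) ^+ 2 = 2 * (D * s) ^+ 2 + 2 * z ^+ 2 - (D * s - z) ^+ 2 by ring.
  have := sqr_ge0 (D * s - z); rewrite hd; lra.
have : 8 * c k ^+ 2 * (g k * s ^+ 2) <= 8 * (c k * g k) * s ^+ 2.
  have -> : 8 * c k ^+ 2 * (g k * s ^+ 2) = 8 * (c k * g k) * s ^+ 2 * c k by ring.
  rewrite -[leRHS]mulr1 ler_wpM2l //; last exact: le_trans (c_le_g k) (g_le1 k).
  by apply: mulr_ge0; rewrite ?sqr_ge0 // mulr_ge0 // mulr_ge0.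
lra.
Qed.

Let A' := A + curv R d l j *: ((x t)^T *m x t).

(** Collecting the multiples of [info * s ^+ 2]: the growth of the matrix adds 1, the mean
    innovation removes [7 / 4], and the second moment adds [4 * nu <= 1 / 4]. What remains is
    [- 1 / 2]. *)
Lemma step_potential :
  A^T = A -> pd_ge 16 A ->
  step t l j (bid_idx st (x t)) (fun a o =>
    qform A' (th - theta - innov l u a o *: (x t *m invmx A'))) <=
  qform A (th - theta) - info * s ^+ 2 / 2 + 4 / T%:R ^+ 2
  + 18 * (curv R d l j * qform (invmx A') (x t)).
Proof.
move=> sA pA.
have k0 : 0 <= curv R d l j := curv_ge0.
have pA' : pd_ge 16 A' by exact: pd_ge_rank1.
have sA' : A'^T = A' by exact: symmx_rank1.
have uA' : A' \in unitmx by apply: pd_unit pA'.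
set nu := qform (invmx A') (x t).
have nu0 : 0 <= nu by apply: (qform_inv_ge0 _ _ pA').
have nu1 : 16 * nu <= 1.
  apply: le_trans (dotvv_ball (x1 t)).
  exact: (qform_inv_le _ _ pA').
have sE : dotv (th - theta) (x t) = s by rewrite dotvBl.
have -> : step t l j (bid_idx st (x t)) (fun a o =>
    qform A' (th - theta - innov l u a o *: (x t *m invmx A'))) =
  (qform A (th - theta) + curv R d l j * s ^+ 2)
  + (- 2 * s * step t l j (bid_idx st (x t)) (innov l u)
  + nu * step t l j (bid_idx st (x t)) (fun a o => innov l u a o ^+ 2)).
  rewrite -[X in X + (_ + _)](step_cst t l j bidT) -!stepZ -!stepD.
  congr step; apply/funext => a; apply/funext => o.
  by rewrite qform_newton // sE -/A' -/nu; ring.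
have e1 := step_innov.
have e2 : nu * step t l j (bid_idx st (x t)) (fun a o => innov l u a o ^+ 2)
    <= nu * (18 * curv R d l j + 4 * info * s ^+ 2).
  by rewrite ler_wpM2l // step_innov_sq.
have is0 : 0 <= info * s ^+ 2 by rewrite mulr_ge0 ?sqr_ge0 // info_ge0.
have e3 : curv R d l j * s ^+ 2 <= info * s ^+ 2.
  by rewrite ler_wpM2r ?sqr_ge0 // curv_le_info.
have e4 : 16 * nu * (info * s ^+ 2) <= info * s ^+ 2.
  by rewrite -[leRHS]mul1r ler_wpM2r.
move: e1 e2 e3 e4; lra.
Qed.

End Round.
End Environment.

(** * Induction over the rounds *)

Section Induction.
Variables (R : realType) (d T : nat).
Variables (theta : 'rV[R]_d) (x : nat -> 'rV[R]_d).
Variables (G : nat -> R) (mu : nat -> R).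
Variable ker : nat -> nat -> outcome T -> R.
Variable reg : nat -> nat -> R.
Hypothesis env : environment theta x G mu ker reg.

Let T2 := env_T env.
Let d0 := env_d env.
Let T0 : 0 < T%:R :> R. Proof. exact: T_gt0. Qed.
Let K0 : 0 < (nscale T)%:R :> R. Proof. by rewrite ltr0n. Qed.
Let N0 : 0 < (nexp R T)%:R :> R. Proof. exact: nexp_gt0. Qed.
Let e0 : 0 < eps R d T. Proof. exact: eps_gt0. Qed.
Let B0 : 0 < logB R T. Proof. exact: logB_gt0. Qed.

(** Price of a unit of potential: [step_potential] releases [info * s ^+ 2 / 2], and [step_regret]
    charges [24 * nscale / eps] times [info * s ^+ 2]. *)
Definition rate : R := 48 * (nscale T)%:R / eps R d T.
(** The part of [step_regret] without [info], plus rounding errors: [216 = 24 + 48 * 4] adds the one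
    of [step_regret] to that of [step_potential] multiplied by [rate]. *)
Definition drift : R :=
  3 / T%:R + 120 * logB R T / (nexp R T)%:R + 60 * eps R d T
  + 216 * (nscale T)%:R / eps R d T / T%:R ^+ 2.
Definition logdet_max : R := ln (d`!%:R * (16 + T%:R) ^+ d).
(** By [elliptical_step], 18 times the growth of [ln (\det A)] pays the last term of
    [step_potential]. *)
Definition pot (A : 'M[R]_d) (th : 'rV[R]_d) : R :=
  qform A (th - theta) - 18 * ln (\det A).
Definition budget (r : nat) (A : 'M[R]_d) (th : 'rV[R]_d) : R :=
  r%:R * drift + rate * (pot A th + 18 * logdet_max).

Lemma rate_ge0 : 0 <= rate.
Proof. by rewrite divr_ge0 ?(ltW e0) // mulr_ge0. Qed.

Lemma drift_ge0 : 0 <= drift.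
Proof.
have i0 : 0 <= 3 / T%:R :> R by rewrite divr_ge0.
have i1 : 0 <= 120 * logB R T / (nexp R T)%:R.
  by apply: divr_ge0 => //; apply: mulr_ge0; rewrite // ltW.
have i2 : 0 <= 216 * (nscale T)%:R / eps R d T / T%:R ^+ 2.
  by rewrite divr_ge0 ?sqr_ge0 // divr_ge0 ?(ltW e0) // mulr_ge0.
by rewrite /drift; have := ltW e0; lra.
Qed.

(** Here [r] counts the rounds left. Each update changes an entry by at most 1, so after all rounds
    the entries still obey the bound behind [logdet_max]. *)
Definition regular (r : nat) (A : 'M[R]_d) : Prop :=
  [/\ A^T = A, pd_ge 16 A, 0 < \det A &
      forall i j, `|A i j| <= 16 + T%:R - r%:R].

Lemma pot_ge0 r A th : regular r A -> 0 <= pot A th + 18 * logdet_max.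
Proof.
move=> [sA pA dA eA].
have q0 : 0 <= qform A (th - theta).
  by apply: le_trans (pA _); rewrite mulr_ge0 // dotvv_ge0.
have d1 : ln (\det A) <= logdet_max.
  have dle : \det A <= d`!%:R * (16 + T%:R) ^+ d.
    apply: det_le => i j; apply: (le_trans (eA i j)).
    by rewrite gerBl.
  by rewrite /logdet_max ler_ln ?posrE // (lt_le_trans dA).
rewrite /pot; lra.
Qed.

Lemma budget_ge0 r r' A th : regular r A -> 0 <= budget r' A th.
Proof.
move=> rA; apply: addr_ge0; first by rewrite mulr_ge0 // drift_ge0.
by rewrite mulr_ge0 ?rate_ge0 // (pot_ge0 _ rA).
Qed.

Lemma round_potential t (l : seq (outcome T)) A th r :
  (nexp R T <= size l)%N -> accurate G l -> regular r A ->
  let st := (l, A, th) in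
  step d ker t l (pos T (dotv th (x t))) (bid_idx st (x t))
    (fun a o => reg t (bid_idx st (x t) a)
       + rate * pot (upd st (x t) a o).1.2 (upd st (x t) a o).2)
  <= drift + rate * pot A th.
Proof.
move=> sl acc [sA pA dA eA] /=.
have nsz : (size l < nexp R T)%N = false by rewrite ltnNge sl.
have reg1 := step_regret env t A th sl acc.
have pot1 := step_potential env t th sl acc sA pA.
have k0 : 0 <= curv R d l (pos T (dotv th (x t))) := curv_ge0 env _ _ _.
have s16 : 0 < 16 :> R by [].
have := elliptical_step (x t) s16 k0 pA sA dA.
rewrite stepD.
set u := dotv th (x t) in reg1 pot1 k0 *.
set A' := A + _ in pot1 * => ell.
have -> : step d ker t l (pos T u) (bid_idx (l, A, th) (x t))
   (fun a o => rate * pot (upd (l, A, th) (x t) a o).1.2 (upd (l, A, th) (x t) a o).2)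
 = rate * (step d ker t l (pos T u) (bid_idx (l, A, th) (x t)) (fun a o =>
      qform A' (th - theta - innov l u a o *: (x t *m invmx A')))
     - 18 * ln (\det A')).
  rewrite stepZ; congr (_ * _).
  have bT a : (bid_idx (l, A, th) (x t) a <= T)%N.
    rewrite /bid_idx nsz; case: a => [[k []]|]; exact: geq_minl.
  rewrite -(step_cst env t l (pos T u) bT (18 * ln (\det A'))) -mulN1r -stepZ -stepD.
  congr step; apply/funext => a; apply/funext => o.
  rewrite mulN1r /pot /upd nsz /= -/u -/A'.
  by rewrite addrAC.
set S := step _ _ _ _ _ _ _ in pot1 *; set I := \sum_(k < _) _ in reg1 pot1.
rewrite /drift /pot; move: pot1 reg1 ell.
set S2 := step _ _ _ _ _ _ _ => pot1 reg1 ell.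
have h1 : rate * (S - 18 * ln (\det A')) <=
   rate * (qform A (th - theta) - 18 * ln (\det A)) + rate * (4 / T%:R ^+ 2)
   - rate * (I * (u - dotv theta (x t)) ^+ 2 / 2).
  rewrite -mulrDr -mulrBr ler_wpM2l ?rate_ge0 //; lra.
apply: (le_trans (lerD reg1 h1)); rewrite /rate.
have -> : 24 * (nscale T)%:R / eps R d T *
    (I * (u - dotv theta (x t)) ^+ 2 + T%:R ^- 2) =
  48 * (nscale T)%:R / eps R d T * (I * (u - dotv theta (x t)) ^+ 2 / 2) +
  24 * (nscale T)%:R / eps R d T / T%:R ^+ 2 by field; rewrite !gt_eqF.
have -> : 48 * (nscale T)%:R / eps R d T * (4 / T%:R ^+ 2) =
  192 * (nscale T)%:R / eps R d T / T%:R ^+ 2 by ring.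
have -> : 216 * (nscale T)%:R / eps R d T / T%:R ^+ 2 =
  192 * (nscale T)%:R / eps R d T / T%:R ^+ 2 +
  24 * (nscale T)%:R / eps R d T / T%:R ^+ 2 by ring.
lra.
Qed.

Lemma regular_upd r t (l : seq (outcome T)) A th a o :
  (nexp R T <= size l)%N -> accurate G l -> regular r.+1 A ->
  regular r (upd (l, A, th) (x t) a o).1.2.
Proof.
move=> sl acc [sA pA dA eA]; rewrite /upd ltnNge sl /=.
have k0 : 0 <= curv R d l (pos T (dotv th (x t))) := curv_ge0 env _ _ _.
have s16 : 0 < 16 :> R by [].
have k1 : curv R d l (pos T (dotv th (x t))) <= 1 := curv_le1 env _ _ acc.
split.
- exact: symmx_rank1.
- exact: pd_ge_rank1.
- exact: (det_rank1_gt0 _ s16).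
- move=> i j; rewrite !mxE big_ord1 !mxE.
  have h : `|curv R d l (pos T (dotv th (x t))) * (x t ord0 i * x t ord0 j)| <= 1.
    rewrite !normrM ger0_norm // mulr_ile1 ?mulr_ge0 //.
    by rewrite mulr_ile1 // ball_coord //; apply: env_x env _.
  apply: (le_trans (ler_normD _ _)); have := eA i j.
  rewrite -natr1; lra.
Qed.

Lemma rtgS r t st : rtg x ker reg r.+1 t st =
  step d ker t st.1.1 (pos T (dotv st.2 (x t))) (bid_idx st (x t))
    (fun a o => reg t (bid_idx st (x t) a) + rtg x ker reg r t.+1 (upd st (x t) a o)).
Proof. by []. Qed.

Lemma rtg_explored r t (l : seq (outcome T)) A th :
  (nexp R T <= size l)%N -> accurate G l -> regular r A ->
  rtg x ker reg r t (l, A, th) <= budget r A th.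
Proof.
move=> sl acc; elim: r t A th => [|r IH] t A th rA.
  exact: budget_ge0 rA.
have nsz : (size l < nexp R T)%N = false by rewrite ltnNge sl.
have bT a : (bid_idx (l, A, th) (x t) a <= T)%N.
  rewrite /bid_idx nsz; case: a => [[k []]|]; exact: geq_minl.
set F := fun a o => (reg t (bid_idx (l, A, th) (x t) a)
   + rate * pot (upd (l, A, th) (x t) a o).1.2 (upd (l, A, th) (x t) a o).2).
rewrite rtgS; apply: (@le_trans _ _ (step d ker t l (pos T (dotv th (x t)))
   (bid_idx (l, A, th) (x t))
   (fun a o => F a o + (r%:R * drift + rate * (18 * logdet_max))))).
  apply: (step_le env) => a o; rewrite /F.
  rewrite [X in rtg _ _ _ _ _ X](_ : _ = (l, (upd (l, A, th) (x t) a o).1.2,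
      (upd (l, A, th) (x t) a o).2)); last by rewrite /upd nsz.
  have := IH t.+1 _ (upd (l, A, th) (x t) a o).2 (regular_upd t th a o sl acc rA).
  rewrite /budget mulrDr /=; lra.
rewrite stepD (step_cst env _ _ _ bT).
have := round_potential t th sl acc rA.
by rewrite /= -/F /budget -natr1 mulrDl mul1r mulrDr; lra.
Qed.

(** Apply the regret bound with the whole grid as interval and the bid itself as [y]. *)
Lemma reg_le2 t b : (b <= T)%N -> reg t b <= 2.
Proof.
move=> bT.
have b01 : 0 <= gpt R T b <= 1.
  by rewrite /gpt divr_ge0 //= ler_pdivrMr // mul1r ler_nat.
have h : gpt R T b = clip01 (gpt R T b).
  by move: b01 => /andP[h0 h1]; rewrite /clip01 min_r // max_r.
have bT' : (0 <= b <= T)%N := bT.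
apply: le_trans (env_reg_le env (t := t) bT' (leqnn T) h _) _.
  rewrite /gpt mul0r divff ?gt_eqF // /clip01 ge_max le_max lexx /= ler01.
  by rewrite ge_min lexx.
rewrite -[leRHS]mulr1; apply: ler_pM => //.
- by rewrite subr_ge0; apply: (env_G_mono env); rewrite leqnn.
- have := tau_itv env t; move: b01; rewrite ler_norml; lra.
- by apply: (mass_le1 env); rewrite leqnn.
Qed.

Lemma bid_idx_le st t (a : action T) : (bid_idx (R := R) (d := d) st (x t) a <= T)%N.
Proof.
rewrite /bid_idx; case: ifP => // _.
by case: a => [[k []]|]; exact: geq_minl.
Qed.

Lemma rtg_le2 r t st : rtg x ker reg r t st <= r%:R * 2.
Proof.
elim: r t st => [|r IH] t st; first by rewrite mul0r.
rewrite rtgS.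
rewrite -(step_cst env t st.1.1 (pos T (dotv st.2 (x t))) (bid_idx_le st t) (r.+1%:R * 2)).
apply: (step_le env) => a o.
rewrite -natr1 mulrDl mul1r addrC lerD //.
exact/reg_le2/bid_idx_le.
Qed.

(* Markov bounds, on the exponential moments of [hits], for the two deviations that
   violate [accurate] on [(lo, hi]], after [i] further exploration rounds. *)
Definition tail (l : seq (outcome T)) (i lo hi : nat) : R :=
  (expR ((hits l lo hi)%:R / 2) * (1 + mass G lo hi) ^+ i
     / expR (logB R T + (nexp R T)%:R * mass G lo hi))
  + (expR (- (hits l lo hi)%:R) * (1 - mass G lo hi / 2) ^+ i
     / expR (logB R T - (nexp R T)%:R * mass G lo hi / 2)).

Definition tails (l : seq (outcome T)) (i : nat) : R :=
  \sum_(lo < T.+1) \sum_(hi < T.+1 | (lo <= hi)%N) tail l i lo hi.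

Lemma expR_half_le2 : expR (1 / 2) <= 2 :> R.
Proof.
have h := expR_ge1Dx (- (1 / 2) : R).
have := expR_gt0 (1 / 2 : R) => p.
have : expR (1 / 2) * expR (- (1 / 2)) = 1 :> R by rewrite -expRD subrr expR0.
move: h p; move: (expR (1 / 2)) (expR (- (1 / 2))) => a b; nra.
Qed.

Lemma expRN1_le_half : expR (- 1) <= 1 / 2 :> R.
Proof.
have h := expR_ge1Dx (1 : R).
have : expR 1 * expR (- 1) = 1 :> R by rewrite -expRD subrr expR0.
move: h (expR_gt0 (-1 : R)); move: (expR 1) (expR (- 1)) => a b; nra.
Qed.

Let ord_le (lo hi : 'I_T.+1) : (lo <= hi)%N -> (lo <= hi <= T)%N.
Proof. by move=> ->; rewrite -ltnS ltn_ord. Qed.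

Lemma tail_ge0 l i lo hi : (lo <= hi <= T)%N -> 0 <= tail l i lo hi.
Proof.
move=> h; have g0 := mass_ge0 env h; have g1 := mass_le1 env h.
by apply: addr_ge0; rewrite divr_ge0 ?expR_ge0 // mulr_ge0 ?expR_ge0 // exprn_ge0 //; lra.
Qed.

Lemma tails_ge0 l i : 0 <= tails l i.
Proof.
apply: sumr_ge0 => lo _; apply: sumr_ge0 => hi h; apply: tail_ge0; exact: ord_le.
Qed.

Lemma hits_rcons (l : seq (outcome T)) o lo hi :
  hits (rcons l o) lo hi = (hits l lo hi + seen o lo hi)%N.
Proof. by rewrite /hits -cats1 count_cat /= addn0. Qed.

(** A supermartingale property. Since [expR (1 / 2) <= 2] and [expR (- 1) <= 1 / 2], one more
    observation multiplies the two exponentials by at most [1 + m] and [1 - m / 2] in mean, exactly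
    the factors given up when [i] drops by one. *)
Lemma tail_mean t l i lo hi : (lo <= hi <= T)%N ->
  \sum_o ker t T o * tail (rcons l o) i lo hi <= tail l i.+1 lo hi.
Proof.
move=> h; have g0 := mass_ge0 env h; have g1 := mass_le1 env h.
have /andP[h1 h2] := h.
have gE := env_ker_seen env t h1 (_ : (hi <= T <= T)%N).
have {}gE := gE _; rewrite h2 leqnn in gE; have {gE} := gE isT.
rewrite -/(mass G lo hi) => gE.
have s1 := env_ker_sum1 env t (leqnn T).
set m := mass G lo hi in g0 g1 gE *.
have D01 o : ((seen o lo hi)%:R == 0 :> R) || ((seen o lo hi)%:R == 1 :> R).
  by case: seen; rewrite eqxx ?orbT.
have up : \sum_o ker t T o * expR ((seen o lo hi)%:R / 2) <= 1 + m.
  rewrite -gE -[X in X + _]s1 -big_split; apply: ler_sum => o _ /=.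
  rewrite -[X in X + _]mulr1 -mulrDr ler_wpM2l ?(env_ker_ge0 env) //.
  case: seen; last by rewrite mul0r expR0 addr0.
  exact: expR_half_le2.
have dn : \sum_o ker t T o * expR (- (seen o lo hi)%:R) <= 1 - m / 2.
  rewrite -gE -[X in X - _]s1 mulr_suml -sumrB; apply: ler_sum => o _ /=.
  rewrite -[X in X - _]mulr1 -mulrA -mulrBr ler_wpM2l ?(env_ker_ge0 env) //.
  case: seen; last by rewrite mul0r mulr0n oppr0 expR0 addr0.
  have -> : true%:R = 1 :> R by [].
  by apply: (le_trans expRN1_le_half); lra.
rewrite /tail -/m.
have -> : \sum_o ker t T o *
   (expR ((hits (rcons l o) lo hi)%:R / 2) * (1 + m) ^+ i /
      expR (logB R T + (nexp R T)%:R * m) +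
    expR (- (hits (rcons l o) lo hi)%:R) * (1 - m / 2) ^+ i /
      expR (logB R T - (nexp R T)%:R * m / 2)) =
  (\sum_o ker t T o * expR ((seen o lo hi)%:R / 2)) *
    (expR ((hits l lo hi)%:R / 2) * (1 + m) ^+ i /
      expR (logB R T + (nexp R T)%:R * m)) +
  (\sum_o ker t T o * expR (- (seen o lo hi)%:R)) *
    (expR (- (hits l lo hi)%:R) * (1 - m / 2) ^+ i /
      expR (logB R T - (nexp R T)%:R * m / 2)).
  rewrite !mulr_suml -big_split; apply: eq_bigr => o _ /=.
  rewrite hits_rcons natrD.
  have -> : ((hits l lo hi)%:R + (seen o lo hi)%:R) / 2 =
     (hits l lo hi)%:R / 2 + (seen o lo hi)%:R / 2 :> R by rewrite mulrDl.
  by rewrite opprD !expRD; ring.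
rewrite !exprS; apply: lerD.
  apply: le_trans (ler_wpM2r _ up) _.
    by rewrite divr_ge0 ?expR_ge0 // mulr_ge0 ?expR_ge0 // exprn_ge0 //; lra.
  by rewrite le_eqVlt; apply/orP; left; apply/eqP; ring.
apply: le_trans (ler_wpM2r _ dn) _.
  by rewrite divr_ge0 ?expR_ge0 // mulr_ge0 ?expR_ge0 // exprn_ge0 //; lra.
by rewrite le_eqVlt; apply/orP; left; apply/eqP; ring.
Qed.

Lemma tails_mean t l i : \sum_o ker t T o * tails (rcons l o) i <= tails l i.+1.
Proof.
have -> : \sum_o ker t T o * tails (rcons l o) i =
  \sum_(lo < T.+1) \sum_(hi < T.+1 | (lo <= hi)%N)
    \sum_o ker t T o * tail (rcons l o) i lo hi.
  under eq_bigr => o _ do (rewrite mulr_sumr; under eq_bigr => lo _ do rewrite mulr_sumr).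
  rewrite exchange_big /=; apply: eq_bigr => lo _.
  by rewrite exchange_big.
apply: ler_sum => lo _; apply: ler_sum => hi h; apply: tail_mean; exact: ord_le.
Qed.

(** All terms are nonnegative, so each is below 1 and its exponent is negative. With [c] hits and
    [N = nexp] this reads [c < 2 logB + 2 N m] and [N m < 2 logB + 2 c]. If [c >= 4 logB] these give
    [c / 4 <= N m <= 3 c]; if [c < 4 logB] they give [N m < 10 logB]. *)
Lemma accurate_of_tails l : tails l 0 < 1 -> accurate G l.
Proof.
move=> h lo hi lohi; have g0 := mass_ge0 env lohi.
have hlt : (hi < T.+1)%N by case/andP: lohi.
have llt : (lo < T.+1)%N by case/andP: lohi => h1 h2; rewrite ltnS (leq_trans h1).
have {h} : tail l 0 lo hi < 1.
  apply: le_lt_trans h; rewrite /tails (bigD1 (Ordinal llt)) //= .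
  rewrite (bigD1 (Ordinal hlt)) /=; last by case/andP: lohi.
  rewrite -addrA lerDl addr_ge0 // sumr_ge0 //.
    by move=> hi' /andP[h1 _]; apply: tail_ge0; rewrite h1 -ltnS ltn_ord.
  move=> lo' _; apply: sumr_ge0 => hi' h1; apply: tail_ge0; exact: ord_le.
rewrite /tail !expr0 !mulr1 -!expRB.
set m := mass G lo hi in g0 *; set c := (hits l lo hi)%:R => h.
have c0 : 0 <= c by [].
have h1 : c / 2 - (logB R T + (nexp R T)%:R * m) < 0.
  rewrite -expR_lt1; apply: le_lt_trans h; rewrite lerDl expR_ge0 //.
have h2 : - c - (logB R T - (nexp R T)%:R * m / 2) < 0.
  rewrite -expR_lt1; apply: le_lt_trans h; rewrite lerDr expR_ge0 //.
rewrite /ghat -/c; case: ifP => hc.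
  split.
  - rewrite ler_pdivrMr ?mulr_gt0 //; lra.
  - move=> _; rewrite mulrA ler_pdivlMr ?mulr_gt0 //; lra.
  - move=> /eqP; rewrite mulf_eq0 invr_eq0 (gt_eqF (mulr_gt0 _ N0)) // orbF.
    by move=> /eqP cE; move: hc; rewrite cE; have := B0; lra.
move: hc => /negbT; rewrite -ltNge => hc.
split => //; first by rewrite ltxx.
by move=> _; rewrite ler_pdivlMr //; lra.
Qed.

(** At the end of exploration either [tails l 0 < 1], so that the estimates are accurate, or
    [tails l 0 >= 1] and the last summand covers the trivial bound of 2 per round. Backwards through
    exploration, [tails_mean] carries this summand along. *)
Lemma rtg_exploring i r t l : (i + size l = nexp R T)%N -> (r <= T)%N ->
  rtg x ker reg (i + r) t (l, 16%:M, 0) <=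
  i%:R * 2 + budget r 16%:M 0 + r%:R * 2 * tails l i.
Proof.
move=> + rT; have rA : regular r 16%:M.
  split.
  - exact: tr_scalar_mx.
  - by move=> v; rewrite /qform mul_mx_scalar -scalemxAl mxE mulmx_trE.
  - by rewrite det_scalar exprn_gt0.
  - move=> a b; rewrite mxE; have : r%:R <= T%:R :> R by rewrite ler_nat.
    by case: eqP => _; rewrite ?mulr1n ?mulr0n ?normr0 ?ger0_norm //; lra.
elim: i t l => [|i IH] t l sl.
  rewrite mul0r add0r add0n.
  have [small|big] := ltP (tails l 0) 1.
    apply: (le_trans (rtg_explored _ _ _ (accurate_of_tails small) rA)).
      by rewrite -sl.
    by rewrite lerDl mulr_ge0 ?tails_ge0 // mulr_ge0.
  apply: (le_trans (rtg_le2 _ _ _)); rewrite -[leLHS]add0r lerD //.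
    exact: budget_ge0 rA.
  by rewrite -[leLHS]mulr1 ler_wpM2l // mulr_ge0.
have szl : (size l < nexp R T)%N by rewrite -sl; lia.
rewrite addSn rtgS.
have bidE a : bid_idx (l, 16%:M, 0) (x t) a = T by rewrite /bid_idx szl.
have out f : step d ker t l (pos T (dotv 0 (x t))) (bid_idx (l, 16%:M, 0) (x t))
    (fun a o => f o) = \sum_o ker t T o * f o.
  rewrite -[RHS](step_cst env t l (pos T (dotv 0 (x t))) (bid_idx_le (l, 16%:M, 0) t)).
  rewrite /step !bidE; have s1 := env_ker_sum1 env t (leqnn T).
  by rewrite -!mulr_suml s1 mul1r; congr (_ + _); apply: eq_bigr => k _;
    rewrite !bidE -!mulr_suml s1 mul1r.
set F := fun o => 2 + (i%:R * 2 + budget r 16%:M 0 + r%:R * 2 * tails (rcons l o) i).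
apply: (@le_trans _ _ (step d ker t l (pos T (dotv 0 (x t)))
    (bid_idx (l, 16%:M, 0) (x t)) (fun a o => F o))).
  apply: (step_le env) => a o; rewrite bidE /upd szl; apply: lerD; first exact: reg_le2.
  by apply: IH; rewrite size_rcons; lia.
rewrite out /F.
have -> : \sum_o ker t T o *
     (2 + (i%:R * 2 + budget r 16%:M 0 + r%:R * 2 * tails (rcons l o) i)) =
   (\sum_o ker t T o) * (2 + i%:R * 2 + budget r 16%:M 0) +
   r%:R * 2 * (\sum_o ker t T o * tails (rcons l o) i).
  rewrite mulr_suml mulr_sumr -big_split; apply: eq_bigr => o _ /=; ring.
rewrite (env_ker_sum1 env t (leqnn T)) mul1r -natr1.
have : r%:R * 2 * (\sum_o ker t T o * tails (rcons l o) i) <= r%:R * 2 * tails l i.+1.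
  by rewrite ler_wpM2l ?tails_mean // mulr_ge0.
lra.
Qed.

(** Before any observation, [(1 + m) ^+ n <= expR (n * m)] and its analogue cancel the mean in the
    denominators, leaving [2 / expR logB] per interval. *)
Lemma tails_nil : tails [::] (nexp R T) <= 2 * (T.+1)%:R ^+ 2 / expR (logB R T).
Proof.
apply: (@le_trans _ _ (\sum_(lo < T.+1) \sum_(hi < T.+1) 2 / expR (logB R T))).
  apply: ler_sum => lo _; rewrite [leRHS](bigID (fun hi : 'I_T.+1 => (lo <= hi)%N)) /=.
  rewrite -[leLHS]addr0; apply: lerD; last first.
    by apply: sumr_ge0 => hi _; rewrite divr_ge0 ?expR_ge0.
  apply: ler_sum => hi /ord_le h.
  have g0 := mass_ge0 env h; have g1 := mass_le1 env h.
  rewrite /tail /hits /= mul0r oppr0 expR0 !mul1r.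
  set m := mass G lo hi in g0 g1 *.
  have e1 : (1 + m) ^+ nexp R T <= expR ((nexp R T)%:R * m).
    by rewrite expRM_natl; apply: lerXn2r; rewrite ?nnegrE ?expR_ge0 ?expR_ge1Dx //; lra.
  have e2 : (1 - m / 2) ^+ nexp R T <= expR (- ((nexp R T)%:R * m / 2)).
    have -> : - ((nexp R T)%:R * m / 2) = (nexp R T)%:R * - (m / 2) by ring.
    rewrite expRM_natl; apply: lerXn2r;
      rewrite ?nnegrE ?expR_ge0 ?expR_ge1Dx //; lra.
  rewrite !expRD !invfM.
  have i0 : 0 <= (expR (logB R T))^-1 by rewrite invr_ge0 expR_ge0.
  rewrite [leRHS](_ : _ = (expR (logB R T))^-1 + (expR (logB R T))^-1); last by ring.
  apply: lerD.
    rewrite mulrCA -[leRHS]mulr1 ler_wpM2l //.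
    by rewrite ler_pdivrMr ?expR_gt0 // mul1r.
  rewrite mulrCA -[leRHS]mulr1 ler_wpM2l //.
  by rewrite ler_pdivrMr ?expR_gt0 // mul1r.
rewrite sumr_const sumr_const !card_ord -[_ *+ _ *+ _]mulr_natr -[(_ / _) *+ _]mulr_natr.
by rewrite le_eqVlt; apply/orP; left; apply/eqP; ring.
Qed.

Theorem rtg_bound : rtg x ker reg T 0 (st0 R d T) <=
  2 * (nexp R T)%:R + T%:R * drift + rate * (16 + 18 * logdet_max)
  + 4 * T%:R * (T.+1)%:R ^+ 2 / expR (logB R T).
Proof.
have q0 : 0 <= 4 * T%:R * (T.+1)%:R ^+ 2 / expR (logB R T) :> R.
  by rewrite divr_ge0 ?expR_ge0 // mulr_ge0 ?sqr_ge0 // mulr_ge0.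
have d1 : 0 <= T%:R * drift by rewrite mulr_ge0 // drift_ge0.
have ldm : 0 <= logdet_max.
  rewrite ln_ge0 // -natrD -natrX -natrM ler1n muln_gt0 fact_gt0 expn_gt0 //.
have r1 : 0 <= rate * (16 + 18 * logdet_max) by rewrite mulr_ge0 ?rate_ge0 //; lra.
have [NT|TN] := leqP (nexp R T) T; last first.
  apply: (le_trans (rtg_le2 _ _ _)).
  have : T%:R <= (nexp R T)%:R :> R by rewrite ler_nat ltnW.
  lra.
have e : (nexp R T + (T - nexp R T))%N = T by rewrite subnKC.
rewrite -[X in rtg _ _ _ X]e.
apply: (le_trans (rtg_exploring 0 (l := [::]) _ (leq_subr _ _))); first by rewrite addn0.
have rT : (T - nexp R T)%:R <= T%:R :> R by rewrite ler_nat leq_subr.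
have p16 : pot 16%:M 0 <= 16.
  rewrite /pot /qform mul_mx_scalar -scalemxAl mxE mulmx_trE det_scalar.
  have -> : dotv (0 - theta) (0 - theta) = dotv theta theta.
    by apply: eq_bigr => i _; rewrite !mxE sub0r mulrNN.
  have := dotvv_ball (env_theta env).
  have : 0 <= ln ((16 : R) ^+ d) by rewrite ln_ge0 // exprn_ege1 // ler1n.
  lra.
have b1 : budget (T - nexp R T) 16%:M 0 <= T%:R * drift + rate * (16 + 18 * logdet_max).
  apply: lerD; first by rewrite ler_wpM2r // drift_ge0.
  by rewrite ler_wpM2l ?rate_ge0 // lerD2r.
have t1 : (T - nexp R T)%:R * 2 * tails [::] (nexp R T) <=
    4 * T%:R * (T.+1)%:R ^+ 2 / expR (logB R T).
  apply: (@le_trans _ _ (T%:R * 2 * (2 * (T.+1)%:R ^+ 2 / expR (logB R T)))).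
    by apply: ler_pM; rewrite ?tails_nil ?tails_ge0 ?mulr_ge0 // ler_wpM2r.
  by rewrite le_eqVlt; apply/orP; left; apply/eqP; ring.
lra.
Qed.

End Induction.

(** * Arithmetic of the final rate *)

Section Rates.
Variables (R : realType) (d T : nat).
Hypothesis T2 : (2 <= T)%N.
Hypothesis d0 : (0 < d)%N.

Let L : R := ln T%:R.
Let S : R := Num.sqrt (d%:R * T%:R).

Let T0 : 0 < T%:R :> R. Proof. exact: T_gt0. Qed.
Let T2R : 2 <= T%:R :> R. Proof. by rewrite ler_nat. Qed.
Let d1 : 1 <= d%:R :> R. Proof. by rewrite ler1n. Qed.

Lemma lnT_ge_half : 1 / 2 <= L.
Proof.
rewrite -[leLHS]expRK ler_ln ?posrE ?expR_gt0 //.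
exact: le_trans (expR_half_le2 R) T2R.
Qed.

Let L0 : 0 < L. Proof. by have := lnT_ge_half; lra. Qed.

Lemma sqrtT_le : Num.sqrt T%:R <= S.
Proof. by rewrite ler_sqrt ?mulr_gt0 ?ltr0n // ler_peMl. Qed.

Lemma sqrtT_ge1 : 1 <= Num.sqrt T%:R :> R.
Proof. by rewrite -[leLHS]sqrtr1 ler_sqrt ?ler1n ?ler0n // ltnW. Qed.

Let S1 : 1 <= S. Proof. exact: le_trans sqrtT_ge1 sqrtT_le. Qed.

Lemma nexp_le : (nexp R T)%:R <= 2 * S.
Proof.
have s0 : 0 <= Num.sqrt T%:R :> R by exact: sqrtr_ge0.
have /andP[h _] := truncn_itv s0.
rewrite /nexp -natr1; have := sqrtT_le; have := S1; lra.
Qed.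

Lemma T_div_nexp : T%:R / (nexp R T)%:R <= S.
Proof.
rewrite ler_pdivrMr ?nexp_gt0 //.
have s0 : 0 <= Num.sqrt T%:R :> R by exact: sqrtr_ge0.
have /andP[_ h] := truncn_itv s0.
rewrite -[leLHS]sqr_sqrtr ?ler0n // expr2.
by apply: ler_pM => //; [exact: sqrtT_le|exact: ltW].
Qed.

Lemma eps_mul : eps R d T * S = d%:R.
Proof.
rewrite /eps /S -sqrtrM ?divr_ge0 //.
have -> : d%:R / T%:R * (d%:R * T%:R) = d%:R ^+ 2 :> R by field; rewrite gt_eqF.
by rewrite sqrtr_sqr ger0_norm.
Qed.

Lemma T_mul_eps : T%:R * eps R d T = S.
Proof.
have e0 := eps_gt0 R T2 d0.
have : (T%:R * eps R d T) ^+ 2 = S ^+ 2.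
  rewrite exprMn !sqr_sqrtr ?divr_ge0 ?mulr_ge0 //.
  by field; rewrite gt_eqF.
move/eqP; rewrite eqf_sqr => /orP[/eqP//|/eqP h].
have : 0 < T%:R * eps R d T by rewrite mulr_gt0.
rewrite h oppr_gt0 ltNge (le_trans _ S1) //.
Qed.

Lemma invr_eps : (eps R d T)^-1 = S / d%:R.
Proof.
have e0 := eps_gt0 R T2 d0.
have s0 : 0 < S by exact: lt_le_trans ltr01 S1.
by rewrite -eps_mul; field; rewrite !gt_eqF.
Qed.

Lemma nscale_le : (nscale T)%:R <= 10 * L.
Proof.
have h : (trunc_log 2 T)%:R * (1 / 2) <= L.
  have l2 : 1 / 2 <= ln (2 : R).
    by rewrite -[leLHS]expRK ler_ln ?posrE ?expR_gt0 // expR_half_le2.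
  apply: (@le_trans _ _ ((trunc_log 2 T)%:R * ln 2)); first by rewrite ler_wpM2l.
  rewrite mulr_natl -lnXn // ler_ln ?posrE ?exprn_gt0 //.
  by rewrite -natrX ler_nat trunc_logP //; lia.
have -> : (nscale T)%:R = (trunc_log 2 T)%:R + 4 :> R.
  by rewrite /nscale -addn4 natrD.
by have := lnT_ge_half; lra.
Qed.

(** From [d! <= d ^ d <= T ^ d] and [16 + T <= 16 * T <= T ^ 5], the latter two for [T >= 2]. *)
Lemma logdet_max_le : (d <= T)%N -> logdet_max R d T <= 6 * d%:R * L.
Proof.
move=> dT.
have h1 : d`!%:R * (16 + T%:R) ^+ d <= T%:R ^+ d * (T%:R ^+ 5) ^+ d :> R.
  apply: ler_pM => //.
    rewrite -natrX ler_nat; apply: (@leq_trans (d ^ d)); last by rewrite leq_exp2r.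
    by rewrite -ffactnn -[X in (_ <= _ ^ X)%N]card_ord ffact_prod -prod_nat_const;
      apply: leq_prod => i _; exact: leq_subr.
  rewrite lerXn2r ?nnegrE ?addr_ge0 // ?exprn_ge0 //.
  have : 16 * T%:R <= T%:R ^+ 5 :> R.
    rewrite exprS mulrC ler_wpM2l //.
    have -> : 16 = 2 ^+ 4 :> R by ring.
    by rewrite lerXn2r ?nnegrE.
  by have := T2R; lra.
rewrite /logdet_max; apply: (@le_trans _ _ (ln (T%:R ^+ d * (T%:R ^+ 5) ^+ d))).
  have p1 : 0 < d`!%:R * (16 + T%:R) ^+ d :> R.
    by rewrite mulr_gt0 ?ltr0n ?fact_gt0 // exprn_gt0 // addr_gt0.
  by rewrite ler_ln ?posrE // (lt_le_trans p1 h1).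
rewrite -exprM -exprD lnXn // -[_ *+ (_ + _)]mulr_natl natrD natrM -/L.
by rewrite le_eqVlt; apply/orP; left; apply/eqP; ring.
Qed.

Lemma expR_logB : expR (logB R T) = T%:R ^+ 7.
Proof. by rewrite /logB expRM_natl lnK // posrE. Qed.

(** The groups bound, in this order, the exploration, the drift, the potential and the failed
    exploration of [final_rate]. *)
Definition regret_const : R :=
  32 + (24 + 7 * 120 * 4 + 60 * 8 + 216 * 10 * 4) + 48 * 10 * 140 * 2 + 8.

Lemma final_rate : (d <= T)%N ->
  2 * (nexp R T)%:R + T%:R * drift R d T
    + rate R d T * (16 + 18 * logdet_max R d T)
    + 4 * T%:R * (T.+1)%:R ^+ 2 / expR (logB R T)
  <= regret_const * (S * L ^+ 3).
Proof.
move=> dT.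
have S0 : 0 <= S by have := S1; lra.
have Lh := lnT_ge_half.
(* Each missing power of [L] costs a factor 2. *)
have L2 : 1 <= 2 * L by lra.
have K1 := nscale_le.
have K0 : 0 <= (nscale T)%:R :> R by [].
have SL2 : S * L ^+ 2 <= 2 * (S * L ^+ 3).
  have -> : 2 * (S * L ^+ 3) = S * L ^+ 2 * (2 * L) by ring.
  by rewrite ler_peMr // mulr_ge0 // sqr_ge0.
have SL1 : S * L <= 4 * (S * L ^+ 3).
  suff : S * L <= 2 * (S * L ^+ 2) by lra.
  have -> : 2 * (S * L ^+ 2) = S * L * (2 * L) by ring.
  by rewrite ler_peMr // mulr_ge0 // ltW.
have SL0 : S <= 8 * (S * L ^+ 3).
  suff : S <= 2 * (S * L) by lra.
  by rewrite mulrCA ler_peMr.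
set X := S * L ^+ 3 in SL0 SL1 SL2 *.
have a1 : 2 * (nexp R T)%:R <= 32 * X by have := nexp_le; lra.
have a2 : T%:R * drift R d T <=
    24 * X + 7 * (120 * (4 * X)) + 60 * (8 * X) + 216 * (10 * (4 * X)).
  have -> : T%:R * drift R d T = 3 + 7 * (120 * (L * (T%:R / (nexp R T)%:R)))
     + 60 * (T%:R * eps R d T) + 216 * ((nscale T)%:R * (S / d%:R / T%:R)).
    rewrite /drift /logB -/L -invr_eps; field.
    by rewrite ?gt_eqF ?nexp_gt0 ?eps_gt0.
  rewrite T_mul_eps; apply: lerD; last first.
    apply: ler_wpM2l; first exact: ler0n.
    apply: (@le_trans _ _ (10 * L * S)).
      apply: ler_pM => //; first by rewrite !divr_ge0.
      rewrite ler_pdivrMr // ler_pdivrMr; last by have := d1; lra.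
      rewrite -mulrA ler_peMr // -[leLHS]mulr1.
      by apply: ler_pM => //; have := T2R; lra.
    by rewrite -mulrA ler_pM2l // mulrC.
  apply: lerD; last by rewrite ler_pM2l.
  apply: lerD; first by have := S1; lra.
  rewrite !ler_pM2l //.
  apply: le_trans SL1; rewrite [leRHS]mulrC ler_pM2l //.
  exact: T_div_nexp.
have a3 : rate R d T * (16 + 18 * logdet_max R d T) <= 48 * (140 * (10 * (2 * X))).
  have dL : 16 <= 32 * (d%:R * L).
    have : 1 * (1 / 2) <= d%:R * L by apply: ler_pM.
    lra.
  have b1 : 16 + 18 * logdet_max R d T <= 140 * (d%:R * L).
    have := logdet_max_le dT; lra.
  have rE : rate R d T = 48 * ((nscale T)%:R * (S / d%:R)).
    by rewrite /rate -invr_eps; ring.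
  rewrite rE.
  apply: (@le_trans _ _ (48 * ((nscale T)%:R * (S / d%:R)) * (140 * (d%:R * L)))).
    by rewrite ler_wpM2l // mulr_ge0 // mulr_ge0 // divr_ge0.
  have -> : 48 * ((nscale T)%:R * (S / d%:R)) * (140 * (d%:R * L)) =
     48 * (140 * ((nscale T)%:R * (S * L))).
    by field; rewrite gt_eqF // ltr0n.
  rewrite !ler_pM2l //; apply: le_trans (_ : 10 * (S * L ^+ 2) <= _).
    have -> : 10 * (S * L ^+ 2) = 10 * L * (S * L) by ring.
    by rewrite ler_wpM2r // mulr_ge0 // ltW.
  by rewrite ler_pM2l.
have a4 : 4 * T%:R * (T.+1)%:R ^+ 2 / expR (logB R T) <= 8 * X.
  apply: (@le_trans _ _ 1); last by have := S1; lra.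
  rewrite expR_logB ler_pdivrMr ?exprn_gt0 // mul1r.
  have t4 : 16 <= T%:R ^+ 4 :> R.
    have -> : 16 = 2 ^+ 4 :> R by ring.
    by rewrite lerXn2r ?nnegrE.
  have t1 : T.+1%:R <= 2 * T%:R :> R by rewrite -natr1; have := T2R; lra.
  have t2 : T.+1%:R ^+ 2 <= 4 * T%:R ^+ 2 :> R.
    have -> : 4 * T%:R ^+ 2 = (2 * T%:R) ^+ 2 :> R by ring.
    by rewrite lerXn2r ?nnegrE // mulr_ge0.
  apply: (@le_trans _ _ (4 * T%:R * (4 * T%:R ^+ 2))).
    by rewrite ler_wpM2l // mulr_ge0.
  have -> : 4 * T%:R * (4 * T%:R ^+ 2) = 16 * T%:R ^+ 3 :> R by ring.
  have -> : T%:R ^+ 7 = T%:R ^+ 4 * T%:R ^+ 3 :> R by ring.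
  by rewrite ler_wpM2r // exprn_ge0.
have -> : regret_const * X = 32 * X +
    (24 * X + 7 * (120 * (4 * X)) + 60 * (8 * X) + 216 * (10 * (4 * X)))
    + 48 * (140 * (10 * (2 * X))) + 8 * X by rewrite /regret_const; ring.
by apply: lerD a4; apply: lerD a3; apply: lerD.
Qed.

Lemma regret_const_gt0 : 0 < regret_const.
Proof. by rewrite !addr_gt0 ?mulr_gt0 ?ltr0n. Qed.

(** For [d > T] already [T <= sqrt (d T)], and [L ^+ 3 >= 1 / 8]; a regret of 2 per round is
    affordable. *)
Lemma trivial_rate : (T < d)%N -> T%:R * 2 <= regret_const * (S * L ^+ 3).
Proof.
move=> Td; have Lh := lnT_ge_half.
have S0 : 0 <= S by have := S1; lra.
have TS : T%:R <= S.
  rewrite -[leLHS]ger0_norm // -sqrtr_sqr ler_sqrt ?mulr_ge0 //.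
  by rewrite expr2 ler_wpM2r // ler_nat ltnW.
have L3 : (1 / 2) ^+ 3 <= L ^+ 3 by rewrite lerXn2r ?nnegrE // ltW.
have h : T%:R * 2 <= 32 * (S * L ^+ 3).
  have -> : T%:R * 2 = 16 * (T%:R * (1 / 2) ^+ 3) :> R by field.
  have -> : 32 * (S * L ^+ 3) = 16 * (S * (2 * L ^+ 3)) by ring.
  rewrite ler_pM2l //; apply: ler_pM => //.
  by have : 0 <= (1 / 2) ^+ 3 :> R by []; lra.
apply: (le_trans h); rewrite ler_wpM2r ?mulr_ge0 ?exprn_ge0 ?(ltW L0) //.
by rewrite /regret_const -[_ + _ + _ + 8]addrA -[_ + _ + (_ + 8)]addrA lerDl !addr_ge0 ?mulr_ge0 ?ler0n.
Qed.

End Rates.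

(** * Expected payoffs and the distribution of the HOB *)

Section Payoff.
Variables (R : realType) (G : probability R R).

Lemma fin_numP (A : set R) : measurable A -> G A \is a fin_num.
Proof. by move=> mA; exact: fin_num_measure. Qed.

Lemma itv_split (b b' : R) : b <= b' ->
  `]-oo, b']%classic = `]-oo, b]%classic `|` `]b, b']%classic.
Proof.
move=> bb; apply/seteqP; split => y /=; rewrite !in_itv /=.
  by move=> yb; have [h|h] := leP y b; [left|right; rewrite yb].
by case=> [h|/andP[]//]; exact: le_trans h bb.
Qed.

Lemma itv_split0 (b b' : R) : 0 <= b -> b <= b' ->
  `[0, b']%classic = `[0, b]%classic `|` `]b, b']%classic.
Proof.
move=> b0 bb; apply/seteqP; split => y /=; rewrite !in_itv /=.
  by move=> /andP[y0 yb]; have [h|h] := leP y b; [left; rewrite y0|right; rewrite yb].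
case=> /andP[h1 h2]; first by rewrite h1 (le_trans h2).
by rewrite h2 andbT (le_trans b0) // ltW.
Qed.

Lemma cdf_diff (b b' : R) : b <= b' ->
  cdf_of G b' - cdf_of G b = fine (G `]b, b']%classic).
Proof.
move=> bb; rewrite /cdf_of (itv_split bb) measureU; try exact: measurable_itv.
  by rewrite fineD ?fin_numP // addrAC subrr add0r.
apply/seteqP; split => y //= [] /=; rewrite !in_itv /= => h /andP[h1 _].
by move: (le_lt_trans h h1); rewrite ltxx.
Qed.

Lemma cdf_itv (b : R) : 0 <= cdf_of G b <= 1.
Proof.
rewrite /cdf_of -!lee_fin fineK ?fin_numP //.
by rewrite measure_ge0 probability_le1.
Qed.

Lemma cdf_mono (b b' : R) : b <= b' -> cdf_of G b <= cdf_of G b'.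
Proof. by move=> bb; rewrite -subr_ge0 cdf_diff // fine_ge0. Qed.

Lemma integral_id_bounds (A : set R) (lo hi : R) : measurable A -> 0 <= lo ->
  (forall m, A m -> lo <= m <= hi) ->
  (lo%:E * G A <= \int[G]_(m in A) m%:E <= hi%:E * G A)%E.
Proof.
move=> mA lo0 h.
have mid : measurable_fun A (EFin : R -> \bar R).
  exact: EFin_measurable.
rewrite -!integral_cst //; apply/andP; split; apply: ge0_le_integral => //.
- by move=> m /h /andP[h1 _]; rewrite /= lee_fin.
- by move=> m /h /andP[h1 _]; rewrite /= lee_fin (le_trans lo0).
- by move=> m /h /andP[_ h1]; rewrite /= lee_fin.
Qed.

Lemma integral_id_fin (A : set R) (hi : R) : measurable A ->
  (forall m, A m -> 0 <= m <= hi) ->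
  (\int[G]_(m in A) m%:E)%E \is a fin_num.
Proof.
move=> mA h; have /andP[h1 h2] := integral_id_bounds mA (lexx 0) h.
rewrite ge0_fin_numE; last by move: h1; rewrite mul0e.
by apply: (le_lt_trans h2); rewrite -(fineK (fin_numP mA)) -EFinM ltry.
Qed.

Lemma partial_mean_diff (b b' : R) : 0 <= b -> b <= b' ->
  b * (cdf_of G b' - cdf_of G b) <= partial_mean G b' - partial_mean G b
    <= b' * (cdf_of G b' - cdf_of G b).
Proof.
move=> b0 bb.
have f1 : (\int[G]_(m in `[0%R, b]%classic) m%:E)%E \is a fin_num.
  by apply: (integral_id_fin (hi := b)) => // m /=; rewrite in_itv.
have mem2 m : `]b, b']%classic m -> b <= m <= b'.
  by rewrite /= in_itv /= => /andP[h1 ->]; rewrite ltW.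
have f2 : (\int[G]_(m in `]b, b']%classic) m%:E)%E \is a fin_num.
  apply: (integral_id_fin (hi := b')) => // m /mem2 /andP[h1 ->].
  by rewrite (le_trans b0).
have -> : partial_mean G b' - partial_mean G b =
    fine (\int[G]_(m in `]b, b']%classic) m%:E)%E.
  rewrite /partial_mean /= (itv_split0 b0 bb) ge0_integral_setU //.
  - by rewrite fineD // addrAC subrr add0r.
  - by move=> m []; rewrite /= in_itv /= => /andP[h _]; rewrite lee_fin // (le_trans b0) // ltW.
  - apply/eqP/seteqP; split => y //= [] /=; rewrite !in_itv /= => /andP[_ h] /andP[h1 _].
    by move: (le_lt_trans h h1); rewrite ltxx.
rewrite cdf_diff // -!lee_fin !EFinM !fineK ?fin_numP //.
exact: integral_id_bounds.
Qed.

Variables (d : nat) (theta x : 'rV[R]_d) (v : R).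
Hypothesis theta1 : in_unit_ball theta.
Hypothesis x1 : in_unit_ball x.
Let tau := dotv theta x.
Let rb := rbar G theta x v.

(** The increment of [rbar] is an integral of [tau - m], which is favourable to [b'] only between
    [b] and [c = clip01 tau]. Any part beyond [c] is dropped, and on the rest the integrand is at
    most [|tau - y|]. *)
Lemma rbar_diff_le (b b' y lo hi : R) : 0 <= b <= 1 -> 0 <= b' <= 1 ->
  b = clip01 y -> lo <= b <= hi -> lo <= clip01 tau <= hi ->
  rb b' - rb b <= `|tau - y| * (cdf_of G hi - cdf_of G lo).
Proof.
move=> /andP[b0 b1] /andP[b'0 b'1] by_ /andP[lob bhi] /andP[loc chi].
have t1 := dotv_le1 theta1 x1.
have tle : tau <= 1 by have := ler_norm (dotv theta x); rewrite /tau; lra.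
set c := clip01 tau in loc chi.
have c01 : 0 <= c <= 1 by rewrite /c /clip01 ge_max le_max lexx ler01 ge_min lexx.
have tc : tau <= c by rewrite /c /clip01 min_r // le_max lexx orbT.
have ct : 0 < c -> c <= tau.
  by rewrite /c /clip01 min_r // lt_max ltxx /= => /ltW h; rewrite max_r.
have n1 := ler_norm (tau - y).
have n2 : - (tau - y) <= `|tau - y| by rewrite -normrN ler_norm.
have n0 := normr_ge0 (tau - y).
(* A bid below 1 is not less than [y], a bid above 0 not greater. So on the side where it matters
   [|tau - y|] dominates [|tau - b|] despite the clipping. *)
have yb : b < 1 -> y <= b.
  rewrite by_ /clip01 => h; rewrite le_max; apply/orP; right.
  rewrite le_min lexx andbT; move: h; rewrite gt_max => /andP[_].
  by rewrite gt_min ltxx /= => /ltW.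
have by0 : 0 < b -> b <= y.
  rewrite by_ /clip01 lt_max ltxx /= => h.
  by rewrite max_r ?ge_min ?lexx ?orbT // ltW.
have pos : 0 <= `|tau - y| * (cdf_of G hi - cdf_of G lo).
  by rewrite mulr_ge0 // subr_ge0 cdf_mono // (le_trans lob).
(* Increments of [rbar] over an interval are controlled by the value of
   [tau - m] at one of its endpoints. *)
have up p q : 0 <= p -> p <= q -> rb q - rb p <= (tau - p) * (cdf_of G q - cdf_of G p).
  move=> p0 pq; have /andP[h _] := partial_mean_diff p0 pq.
  by rewrite /rb /rbar -/tau; lra.
have down p q : 0 <= p -> p <= q -> rb p - rb q <= (q - tau) * (cdf_of G q - cdf_of G p).
  move=> p0 pq; have /andP[_ h] := partial_mean_diff p0 pq.
  by rewrite /rb /rbar -/tau; lra.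
have dF p q : lo <= p -> p <= q -> q <= hi ->
    cdf_of G q - cdf_of G p <= cdf_of G hi - cdf_of G lo.
  by move=> h1 h2 h3; apply: lerB; exact: cdf_mono.
have dF0 p q : p <= q -> 0 <= cdf_of G q - cdf_of G p.
  by move=> h; rewrite subr_ge0 cdf_mono.
have [/andP[c0 c1]] := c01.
have [bb|bb] := leP b b'.
- have [cb|bc] := leP c b.
    apply: (le_trans (up _ _ b0 bb)); apply: le_trans pos.
    by rewrite mulr_le0_ge0 ?dF0 // subr_le0 (le_trans tc).
  have yb' : y <= b by apply: yb; lra.
  have main q : b <= q -> q <= c -> rb q - rb b <=
      `|tau - y| * (cdf_of G hi - cdf_of G lo).
    move=> bq qc; apply: (le_trans (up _ _ b0 bq)).
    apply: (@le_trans _ _ (`|tau - y| * (cdf_of G q - cdf_of G b))).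
      by apply: ler_wpM2r; rewrite ?dF0 //; lra.
    by apply: ler_wpM2l => //; apply: dF => //; exact: le_trans chi.
  have [b'c|cb'] := leP b' c; first exact: main.
  have m1 := main c (ltW bc) (lexx c).
  have := up _ _ c0 (ltW cb').
  have : (tau - c) * (cdf_of G b' - cdf_of G c) <= 0.
    by rewrite mulr_le0_ge0 ?dF0 ?subr_le0 // ltW.
  lra.
- have by' : b <= y by apply: by0; apply: le_lt_trans bb.
  have main q : 0 <= q -> q <= b -> c <= q -> rb q - rb b <=
      `|tau - y| * (cdf_of G hi - cdf_of G lo).
    move=> q0 qb cq; apply: (le_trans (down _ _ q0 qb)).
    apply: (@le_trans _ _ (`|tau - y| * (cdf_of G b - cdf_of G q))).
      by apply: ler_wpM2r; rewrite ?dF0 //; lra.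
    by apply: ler_wpM2l => //; apply: dF => //; exact: le_trans loc _.
  have [cb'|b'c] := leP c b'; first by apply: main => //; exact: ltW.
  have ctau : c <= tau by apply: ct; apply: le_lt_trans b'c.
  have [bc|cb] := leP b c.
    apply: (le_trans (down _ _ b'0 (ltW bb))); apply: le_trans pos.
    by rewrite mulr_le0_ge0 ?dF0 ?(ltW bb) // subr_le0; lra.
  have m1 := main c c0 (ltW cb) (lexx c).
  have := down _ _ b'0 (ltW b'c).
  have : (c - tau) * (cdf_of G c - cdf_of G b') <= 0.
    by rewrite mulr_le0_ge0 ?dF0 ?subr_le0 // ltW.
  lra.
Qed.

Lemma gap_le (b y lo hi : R) : 0 <= b <= 1 ->
  b = clip01 y -> lo <= b <= hi -> lo <= clip01 tau <= hi ->
  gap G theta x v b <= `|tau - y| * (cdf_of G hi - cdf_of G lo).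
Proof.
move=> b01 by_ h1 h2; rewrite /gap lerBlDr; apply: ge_sup.
  by exists (rb b), b => //=; rewrite in_itv.
move=> _ /= [b' + <-]; rewrite in_itv /= => b'01.
by rewrite -lerBlDr; exact: rbar_diff_le.
Qed.

Lemma clip01_id (b : R) : 0 <= b <= 1 -> clip01 b = b.
Proof. by move=> /andP[h1 h2]; rewrite /clip01 min_r // max_r. Qed.

Lemma clip01_itv (b : R) : 0 <= clip01 b <= 1.
Proof. by rewrite /clip01 le_max lexx /= ge_max ler01 ge_min lexx. Qed.

(** The supremum dominates its members only if the set is bounded above; [rbar_diff_le] on all of
    [[0, 1]] provides the bound. *)
Lemma gap_ge0 (b : R) : 0 <= b <= 1 -> 0 <= gap G theta x v b.
Proof.
move=> b01; rewrite /gap subr_ge0; apply: ub_le_sup; last first.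
  by exists b => //=; rewrite in_itv.
exists (`|tau - b| * (cdf_of G 1 - cdf_of G 0) + rb b).
move=> _ /= [b' + <-]; rewrite in_itv /= => b'01; rewrite -lerBlDr.
by apply: rbar_diff_le => //; [rewrite clip01_id|exact: clip01_itv].
Qed.

End Payoff.

(** * Probability space *)

(** Inverse-cdf sampling: [c] is the mass already passed, and [None] takes whatever the list leaves
    over. *)
Fixpoint sample (R : realType) (A : Type) (rho : A -> R) (c : R) (s : seq A) (u : R)
    : option A :=
  if s is a :: s' then
    if u <= c + rho a then Some a else sample rho (c + rho a) s' u
  else None.

Lemma measurable_rv (R : realType) (d : measure_display) (Omega : measurableType d)
    (P : probability Omega R) (U : {RV P >-> R}) (B : set R) :
  measurable B -> measurable (U @^-1` B).
Proof. by move=> mB; rewrite -[X in measurable X]setTI; exact: measurable_funP. Qed.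

Section Sample.
Variables (R : realType) (A : eqType) (rho : A -> R).

Lemma measurable_sample (c : R) (s : seq A) oa :
  measurable [set u | sample rho c s u = oa].
Proof.
elim: s c => [|a s IH] c /=.
  case: oa => [a|].
    by rewrite (_ : [set _ | _] = set0) //; apply/seteqP; split.
  by rewrite (_ : [set _ | _] = setT) //; apply/seteqP; split.
rewrite (_ : [set _ | _] = (`]-oo, (c + rho a)%R] `&` [set u | Some a = oa])
  `|` (`](c + rho a)%R, +oo[ `&` [set u | sample rho (c + rho a) s u = oa])).
  apply: measurableU; apply: measurableI => //.
  have [<-|h] := eqVneq (Some a) oa.
    by rewrite (_ : [set _ | _] = setT) //; apply/seteqP; split.
  rewrite (_ : [set _ | _] = set0) //.
  by apply/seteqP; split => // u /= e; rewrite e eqxx in h.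
apply/seteqP; split => u /=; rewrite !in_itv /= ?andbT; have [h|h] := leP u (c + rho a).
- by left.
- by right.
- by case=> -[].
- by case=> -[].
Qed.

Variables (d : measure_display) (Omega : measurableType d) (P : probability Omega R).
Variable U : {RV P >-> R}.
Hypothesis Uunif : forall r, 0 <= r <= 1 -> P [set w | U w <= r] = r%:E.

Lemma unif_gt (c : R) : 0 <= c <= 1 -> P [set w | c < U w] = (1 - c)%:E.
Proof.
move=> c01.
have -> : [set w | c < U w] = ~` [set w | U w <= c].
  by apply/seteqP; split => w /=; rewrite ltNge => /negP.
rewrite probability_setC ?Uunif //.
have -> : [set w | U w <= c] = U @^-1` `]-oo, c].
  by apply/seteqP; split => w /=; rewrite in_itv.
by apply: measurable_rv; exact: measurable_itv.
Qed.

Lemma unif_itv (p q : R) : 0 <= p -> p <= q -> q <= 1 ->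
  P [set w | p < U w <= q] = (q - p)%:E.
Proof.
move=> p0 pq q1.
have m1 : measurable [set w | p < U w <= q].
  have -> : [set w | p < U w <= q] = U @^-1` `]p, q].
    by apply/seteqP; split => w /=; rewrite in_itv.
  by apply: measurable_rv; exact: measurable_itv.
have m2 : measurable [set w | q < U w].
  have -> : [set w | q < U w] = U @^-1` `]q, +oo[.
    by apply/seteqP; split => w /=; rewrite in_itv /= andbT.
  by apply: measurable_rv; exact: measurable_itv.
have : P ([set w | p < U w <= q] `|` [set w | q < U w]) =
    P [set w | p < U w <= q] + P [set w | q < U w].
  rewrite measureU //; apply/seteqP; split => w //= [/andP[_ h] h'].
  by move: (le_lt_trans h h'); rewrite ltxx.
have -> : [set w | p < U w <= q] `|` [set w | q < U w] = [set w | p < U w].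
  apply/seteqP; split => w /=; first by case=> [/andP[]//|]; exact: le_lt_trans.
  by move=> h; have [h'|h'] := leP (U w) q; [left; rewrite h|right].
rewrite !unif_gt ?p0 ?q1 ?(le_trans pq) ?(le_trans p0) //.
rewrite -(fineK (fin_num_measure P _ m1)) -EFinD => -[h].
by congr EFin; lra.
Qed.

Lemma sample_law (c : R) (s : seq A) oa : uniq s -> 0 <= c ->
  (forall a, 0 <= rho a) -> c + \sum_(a <- s) rho a <= 1 ->
  P [set w | c < U w /\ sample rho c s (U w) = oa] =
  (if oa is Some a then (if a \in s then rho a else 0)
   else 1 - c - \sum_(a <- s) rho a)%:E.
Proof.
move=> + + rho0.
have meas c' s' oa' : measurable [set w | c' < U w /\ sample rho c' s' (U w) = oa'].
  have -> : [set w | c' < U w /\ sample rho c' s' (U w) = oa'] =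
      U @^-1` (`]c', +oo[ `&` [set u | sample rho c' s' u = oa']).
    by apply/seteqP; split => w /=; rewrite in_itv /= andbT.
  by apply: measurable_rv; apply: measurableI; [exact: measurable_itv|exact: measurable_sample].
elim: s c => [|a s IH] c /=.
  move=> _ c0; rewrite big_nil addr0 => c1; case: oa => [a|].
    rewrite (_ : [set _ | _] = set0) ?measure0 ?in_nil //.
    by apply/seteqP; split => w //= [].
  rewrite (_ : [set _ | _] = [set w | c < U w]) ?subr0 ?unif_gt ?c0 //.
  by apply/seteqP; split => w //= [].
move=> /andP[as_ us] c0; rewrite big_cons addrA => c1.
have s0 : 0 <= \sum_(a0 <- s) rho a0 by exact: sumr_ge0.
have ca : 0 <= c + rho a by rewrite addr_ge0.
have {}IH := IH _ us ca c1.
case: (eqVneq (Some a) oa) IH => [<-|neq] IH.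
  rewrite (_ : [set _ | _] = [set w | c < U w <= c + rho a] `|`
     [set w | c + rho a < U w /\ sample rho (c + rho a) s (U w) = Some a]); last first.
    apply/seteqP; split => w /=; have [h|h] := leP (U w) (c + rho a).
    - by case=> -> _; left.
    - by case=> _ ->; right.
    - by case=> [/andP[->]//|[]].
    - by case=> [/andP[_]//|[_ ->]]; split => //; rewrite (le_lt_trans _ h) // lerDl.
  rewrite measureU //; last first.
  - apply/seteqP; split => w //= [/andP[_ h] [h' _]].
    by move: (le_lt_trans h h'); rewrite ltxx.
  - have -> : [set w | c < U w <= c + rho a] = U @^-1` `]c, c + rho a].
      by apply/seteqP; split => w /=; rewrite in_itv.
    by apply: measurable_rv; exact: measurable_itv.
  have h1 : P [set w | c < U w <= c + rho a] = (c + rho a - c)%:E.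
    by apply: unif_itv => //; [rewrite lerDl|lra].
  apply: (etrans (congr2 (fun a b => a + b)%E h1 IH)).
  by rewrite (negbTE as_) inE eqxx adde0 addrAC subrr add0r.
rewrite (_ : [set _ | _] =
    [set w | c + rho a < U w /\ sample rho (c + rho a) s (U w) = oa]).
  rewrite IH; case: oa neq {IH} => [b|] neq; last by congr EFin; ring.
  rewrite inE (_ : (b == a) = false) //; apply/eqP => ba.
  by rewrite ba eqxx in neq.
apply/seteqP; split => w /=; have [h|h] := leP (U w) (c + rho a).
- by case=> _ e; rewrite e eqxx in neq.
- by case.
- by case.
- by case=> _ ->; split => //; rewrite (le_lt_trans _ h) // lerDl.
Qed.

End Sample.

(** * Rounded observations *)

Section Observation.
Variables (R : realType) (T : nat).
Hypothesis T2 : (2 <= T)%N.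

Let T0 : 0 < T%:R :> R. Proof. exact: T_gt0. Qed.

(* [cell_nat m = c] means [m \in ](c - 1) / T, c / T]] on [0, 1]. *)
Definition cell_nat (m : R) : nat := (T - Num.trunc (T%:R * (1 - m)))%N.
Definition level_nat (v : R) : nat := minn T (Num.trunc (T%:R * v)).
Definition obs (won : bool) (y m : R) : outcome T :=
  (if won then Some (inord (cell_nat m)) else None, inord (level_nat y)).
Definition obs3 (b : R) (z : R * R * R) : outcome T :=
  let won := z.2 <= b in obs won (if won then z.1.1 else z.1.2) z.2.

Lemma cell_nat_le (m : R) (k : nat) : (k < T)%N ->
  (cell_nat m <= k)%N = (m <= gpt R T k).
Proof.
move=> kT; rewrite /cell_nat leq_subLR addnC -leq_subLR.
have e : (T - k = (T - k).-1.+1)%N by lia.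
rewrite e truncn_gt_nat -e natrB ?(ltnW kT) // /gpt ler_pdivlMr //.
by rewrite mulrBr mulr1; apply/idP/idP; lra.
Qed.

Lemma seen_obs (b : nat) (lo hi : nat) (z : R * R * R) :
  (lo <= hi)%N -> (hi <= b <= T)%N ->
  seen (obs3 (gpt R T b) z) lo hi = (gpt R T lo < z.2 <= gpt R T hi).
Proof.
move=> lohi /andP[hib bT]; rewrite /obs3 /obs /seen.
have mono i j : (i <= j)%N -> gpt R T i <= gpt R T j.
  by move=> ij; rewrite ler_pM2r ?invr_gt0 // ler_nat.
have [won|lost] := leP z.2 (gpt R T b); last first.
  have h : gpt R T hi < z.2 := le_lt_trans (mono _ _ hib) lost.
  by rewrite [z.2 <= _]leNgt h andbF.
have cT : (cell_nat z.2 <= T)%N by exact: leq_subr.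
rewrite /= inordK ?ltnS //.
have hiE : (cell_nat z.2 <= hi)%N = (z.2 <= gpt R T hi).
  (* At [T] the equivalence of [cell_nat_le] fails for [m > 1], since a cell is never above [T]; but
     there [hi = b], and the win bounds the HOB. *)
  have [hT|hT] := ltnP hi T; first exact: cell_nat_le.
  have -> : hi = b by lia.
  by rewrite won (leq_trans cT) //; lia.
rewrite hiE; have [loT|loT] := ltnP lo T.
  by rewrite ltnNge cell_nat_le // ltNge.
have -> : (lo < cell_nat z.2)%N = false by lia.
have blo : (b <= lo)%N by exact: leq_trans bT loT.
by rewrite ltNge (le_trans won (mono _ _ blo)).
Qed.

Lemma level_obs (b : R) (z : R * R * R) :
  0 <= z.1.1 <= 1 -> 0 <= z.1.2 <= 1 ->
  (if z.2 <= b then z.1.1 else z.1.2) - T%:R^-1 <= level R (obs3 b z)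
    <= (if z.2 <= b then z.1.1 else z.1.2).
Proof.
move=> h1 h2; set y := if _ then _ else _; rewrite /obs3 /obs /level /= -/y.
have /andP[y0 y1] : 0 <= y <= 1 by rewrite /y; case: ifP.
have /andP[t0 t1] := truncn_itv (mulr_ge0 (ltW T0) y0).
have tT : (Num.trunc (T%:R * y)%R <= T)%N.
  rewrite -(ler_nat R) (le_trans t0) // -[leRHS]mulr1 ler_wpM2l //.
have -> : level_nat y = Num.trunc (T%:R * y) by rewrite /level_nat; lia.
rewrite inordK ?ltnS // ler_pdivlMr // ler_pdivrMr //.
move: t1; rewrite -natr1 mulrBl mulVf ?gt_eqF // => t1.
by apply/andP; split; nra.
Qed.

(** The fibres of a monotone map are intervals. *)
Lemma measurable_mono_nat (g : R -> nat) n :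
  {homo g : a b / a <= b >-> (a <= b)%N} -> measurable [set a | g a = n].
Proof.
move=> mono; apply: is_interval_measurable => a b /= ga gb c /andP[ac cb].
apply/eqP; rewrite eqn_leq; apply/andP.
by split; [rewrite -gb|rewrite -ga]; exact: mono.
Qed.

Lemma measurable_cell c : measurable [set m | inord (cell_nat m) = c :> 'I_T.+1].
Proof.
rewrite (_ : [set _ | _] = [set m | cell_nat m = c]).
  apply: measurable_mono_nat => a b ab; apply: leq_sub2l; apply: le_truncn.
  by rewrite ler_pM2l // lerB.
apply/seteqP; split => m /=; first by move=> <-; rewrite inordK // ltnS leq_subr.
by move=> e; apply/val_inj; rewrite /= e inordK.
Qed.

Lemma measurable_level c : measurable [set v | inord (level_nat v) = c :> 'I_T.+1].
Proof.
rewrite (_ : [set _ | _] = [set v | level_nat v = c]).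
  apply: measurable_mono_nat => a b ab; rewrite leq_min geq_minl /=.
  apply: (leq_trans (geq_minr _ _)); apply: le_truncn.
  by rewrite ler_pM2l.
apply/seteqP; split => m /=; first by move=> <-; rewrite inordK // ltnS geq_minl.
by move=> e; apply/val_inj; rewrite /= e inordK.
Qed.

Lemma measurable_obs3 b o : measurable [set z | obs3 b z = o].
Proof.
case: o => c y.
pose pick c' := if c is Some c0 then c' == c0 else false.
have mm (B : set R) : measurable B -> measurable [set z : R * R * R | B z.2].
  by move=> mB; rewrite -[X in measurable X]setTI; exact: measurable_snd.
have m1 (B : set R) : measurable B -> measurable [set z : R * R * R | B z.1.1].
  move=> mB; rewrite -[X in measurable X]setTI.
  by apply: (measurableT_comp (f := fst) (g := fst)) => //; exact: measurable_fst.
have m0 (B : set R) : measurable B -> measurable [set z : R * R * R | B z.1.2].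
  move=> mB; rewrite -[X in measurable X]setTI.
  by apply: (measurableT_comp (f := snd) (g := fst)) => //; exact: measurable_fst.
rewrite (_ : [set _ | _] =
  ([set z | `]-oo, b]%classic z.2] `&` [set z | [set m | Some (inord (cell_nat m)) = c] z.2]
     `&` [set z | [set v | inord (level_nat v) = y] z.1.1])
  `|` ([set z | `]b, +oo[%classic z.2] `&` [set z | [set m | None = c] z.2]
     `&` [set z | [set v | inord (level_nat v) = y] z.1.2])).
  apply: measurableU.
    apply: measurableI; last by apply: m1; exact: measurable_level.
    apply: measurableI; first by apply: mm; exact: measurable_itv.
    apply: mm; case: c {pick} => [c|].
      rewrite (_ : [set _ | _] = [set m | inord (cell_nat m) = c]).
        exact: measurable_cell.
      by apply/seteqP; split => m /= => [[]|->].
    by rewrite (_ : [set _ | _] = set0) //; apply/seteqP; split.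
  apply: measurableI; last by apply: m0; exact: measurable_level.
  apply: measurableI; first by apply: mm; exact: measurable_itv.
  apply: mm; case: c {pick} => [c|].
    by rewrite (_ : [set _ | _] = set0) //; apply/seteqP; split.
  by rewrite (_ : [set _ | _] = setT) //; apply/seteqP; split.
apply/seteqP; split => -[[v1 v0] m] /=; rewrite !in_itv /= /obs3 /obs /= ?andbT;
  have [h|h] := leP m b.
- by move=> [-> ->]; left.
- by move=> [-> ->]; right.
- by case=> [[[_ cE] yE]|[[]//]]; rewrite cE yE.
- by case=> [[[]//]|[[_ cE] yE]]; rewrite cE yE.
Qed.

End Observation.

(** * Expectations through finitely many fibres *)

Section FiniteValued.
Variables (R : realType) (d : measure_display) (Omega : measurableType d).
Variable P : probability Omega R.
Variables (I : finType) (c : Omega -> I).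
Hypothesis mc : forall i, measurable [set w | c w = i].

Lemma integral_fibers (D : set Omega) (f : Omega -> \bar R) :
  measurable D -> measurable_fun D f -> (forall w, D w -> 0 <= f w)%E ->
  (\int[P]_(w in D) f w)%E =
  (\sum_i \int[P]_(w in D `&` [set w | c w = i]) f w)%E.
Proof.
move=> mD mf f0.
have DE : \big[setU/set0]_(i <- index_enum I) (D `&` [set w | c w = i]) = D.
  rewrite -bigcup_seq; apply/seteqP; split => w /=; first by case=> i _ [].
  by move=> Dw; exists (c w) => //=; exact: mem_index_enum.
rewrite -{1}DE ge0_integral_bigsetU ?DE //.
- by move=> i; exact: measurableI.
- exact: index_enum_uniq.
- by move=> i j _ _ [w [[_ <-] [_ <-]]].
Qed.

Lemma measurable_fibers (phi : I -> R) : measurable_fun setT (fun w => phi (c w)).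
Proof.
move=> _ B mB; rewrite setTI.
have -> : (fun w => phi (c w)) @^-1` B =
    \bigcup_(i in [set i | B (phi i)]) [set w | c w = i].
  apply/seteqP; split => w /=; first by move=> h; exists (c w).
  by case=> i /= h e; rewrite e.
by apply: fin_bigcup_measurable => //; exact: finite_finset.
Qed.

Lemma expect_fibers (phi : I -> R) : (forall i, 0 <= phi i) ->
  (\int[P]_w (phi (c w))%:E)%E =
  (\sum_i fine (P [set w | c w = i]) * phi i)%:E.
Proof.
move=> p0; rewrite integral_fibers //; last 2 first.
- apply/measurable_EFinP; exact: measurable_fibers.
- by move=> w _; rewrite lee_fin.
rewrite -sumEFin; apply: eq_bigr => i _; rewrite setTI.
rewrite (eq_integral (cst (phi i)%:E)); last by move=> w; rewrite inE /= => ->.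
by rewrite integral_cst // EFinM fineK ?fin_num_measure // muleC.
Qed.

Lemma sum_fibers : \sum_i fine (P [set w | c w = i]) = 1.
Proof.
have := @expect_fibers (fun=> 1) (fun=> ler01); rewrite integral_cst // mul1e => h.
have [<-] := etrans (esym h) (probability_setT P).
by apply: eq_bigr => i _; rewrite mulr1.
Qed.

End FiniteValued.

(** * Law of the drawn action *)

Section Draw.
Variables (R : realType) (d T : nat).

Definition draw (st : state R d T) (xt : 'rV[R]_d) (u : R) : action T :=
  sample (aprob R d st.1.1 (pos T (dotv st.2 xt))) 0
    (enum {: 'I_(nscale T) * bool}) u.

Definition action_prob (st : state R d T) (xt : 'rV[R]_d) (a : action T) : R :=
  let rho := aprob R d st.1.1 (pos T (dotv st.2 xt)) in
  if a is Some p then rho p else 1 - \sum_p rho p.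

Lemma sum_option (I : finType) (V : nmodType) (F : option I -> V) :
  \sum_a F a = F None + \sum_i F (Some i).
Proof.
rewrite (bigD1 None) //=; congr (_ + _).
rewrite (reindex_omap Some id) //=; last by case.
by apply: eq_bigl => i; rewrite eqxx.
Qed.

Lemma sum_aprob (st : state R d T) (xt : 'rV[R]_d) :
  \sum_p aprob R d st.1.1 (pos T (dotv st.2 xt)) p =
  \sum_(k < nscale T) xprob R d st.1.1 (pos T (dotv st.2 xt)) k / (nscale T)%:R.
Proof.
rewrite -(pair_bigA _ (fun k b => aprob R d st.1.1 (pos T (dotv st.2 xt)) (k, b))) /=.
apply: eq_bigr => k _; rewrite big_bool /aprob /=.
by rewrite -splitr.
Qed.

Hypothesis T2 : (2 <= T)%N.
Hypothesis d0 : (0 < d)%N.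

Lemma step_sum (ker : nat -> nat -> outcome T -> R) t (st : state R d T) xt b
    (F : action T -> outcome T -> R) :
  \sum_(s : action T * outcome T)
    action_prob st xt s.1 * ker t (b s.1) s.2 * F s.1 s.2 =
  step d ker t st.1.1 (pos T (dotv st.2 xt)) b F.
Proof.
rewrite -(pair_bigA _ (fun a o => action_prob st xt a * ker t (b a) o * F a o)) /=.
rewrite sum_option /step; congr (_ + _).
  by rewrite mulr_sumr /action_prob sum_aprob; apply: eq_bigr => o _; rewrite mulrA.
pose H (p : 'I_(nscale T) * bool) :=
  \sum_o action_prob st xt (Some p) * ker t (b (Some p)) o * F (Some p) o.
rewrite (eq_bigr (fun p => H (p.1, p.2))); last by case.
rewrite -(pair_bigA _ (fun k c => H (k, c))) /=.
apply: eq_bigr => k _; rewrite /H big_bool /= /aprob /= mulrA.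
have e c : \sum_o xprob R d st.1.1 (pos T (dotv st.2 xt)) k / (nscale T)%:R / 2 *
      ker t (b (Some (k, c))) o * F (Some (k, c)) o =
   xprob R d st.1.1 (pos T (dotv st.2 xt)) k / (nscale T)%:R / 2 *
    \sum_o ker t (b (Some (k, c))) o * F (Some (k, c)) o.
  by rewrite mulr_sumr; apply: eq_bigr => o _; rewrite mulrA.
by rewrite !e; ring.
Qed.

Variables (dO : measure_display) (Omega : measurableType dO).
Variables (P : probability Omega R) (U : {RV P >-> R}).
Hypothesis Uunif : forall r, 0 <= r <= 1 -> P [set w | U w <= r] = r%:E.

(** [sample_law] at [c = 0] covers all but the null event [U w <= 0], where an action of probability
    0 might be selected. *)
Lemma draw_law st xt a :
  P [set w | draw st xt (U w) = a] = (action_prob st xt a)%:E.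
Proof.
have rho0 p : 0 <= aprob R d st.1.1 (pos T (dotv st.2 xt)) p.
  by rewrite /aprob !divr_ge0 // xprob_ge0.
have law : P [set w | 0 < U w /\ draw st xt (U w) = a] = (action_prob st xt a)%:E.
  rewrite sample_law //; last 2 first.
  - exact: enum_uniq.
  - by rewrite add0r big_enum /= sum_aprob sum_xprob_le1.
  by congr EFin; case: a => [p|] /=; rewrite ?mem_enum ?big_enum ?subr0.
have mA : measurable [set w | draw st xt (U w) = a].
  exact: (measurable_rv U (measurable_sample _ _ _ _)).
have m0 : measurable [set w | U w <= 0].
  rewrite (_ : [set w | U w <= 0] = U @^-1` `]-oo, 0]); last first.
    by apply/seteqP; split => w /=; rewrite in_itv.
  by apply: measurable_rv; exact: measurable_itv.
apply/eqP; rewrite eq_le; apply/andP; split; last first.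
  rewrite -law; apply: le_measure; rewrite ?inE //; last by move=> w /= [].
  rewrite (_ : [set w | _] = [set w | draw st xt (U w) = a] `\` [set w | U w <= 0]).
    exact: measurableD.
  apply/seteqP; split => w /=; first by case=> h ->; rewrite leNgt h.
  by case=> -> /negP; rewrite -ltNge.
rewrite -law -[leRHS]adde0 -[X in (_ + X)%E](Uunif (r := 0)) ?lexx ?ler01 //.
have mB : measurable [set w | 0 < U w /\ draw st xt (U w) = a].
  rewrite (_ : [set w | _] = [set w | draw st xt (U w) = a] `\` [set w | U w <= 0]).
    exact: measurableD.
  apply/seteqP; split => w /=; first by case=> h ->; rewrite leNgt h.
  by case=> -> /negP; rewrite -ltNge.
apply: (le_trans _ (measureU2 _ mB m0)).
apply: le_measure; rewrite ?inE //; first exact: measurableU.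
by move=> w /= h; have [h'|h'] := leP (U w) 0; [right|left].
Qed.

End Draw.

(** * The auction as a finite environment *)

Section Kernel.
Variables (R : realType) (d T : nat) (theta : 'rV[R]_d) (x : nat -> 'rV[R]_d).
Variable G : probability R R.
Variables (dO : measure_display) (Omega : measurableType dO).
Variables (P : probability Omega R) (V1 V0 M : nat -> {RV P >-> R}).
Hypothesis d0 : (0 < d)%N.
Hypothesis T2 : (2 <= T)%N.
Hypothesis theta1 : in_unit_ball theta.
Hypothesis x1 : forall t, in_unit_ball (x t).
Hypothesis G01 : G `[0, 1]%classic = 1%E.
Hypothesis V01 : forall t w, 0 <= V1 t w <= 1 /\ 0 <= V0 t w <= 1.
Hypothesis M_law : forall t (A : set R), measurable A -> P (M t @^-1` A) = G A.
Hypothesis payoffE : forall t b, 0 <= b <= 1 ->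
  ('E_P[fun w => payoff (V1 t w) (V0 t w) (M t w) b] =
   (rbar G theta (x t) (fine ('E_P[V0 t])%E) b)%:E)%E.

Definition won_lost (t : nat) (w : Omega) : R * R * R := (V1 t w, V0 t w, M t w).

Definition obs_at (t b : nat) (w : Omega) : outcome T :=
  obs3 T (gpt R T b) (won_lost t w).

Definition obs_ker (t b : nat) (o : outcome T) : R :=
  fine (P [set w | obs_at t b w = o]).

Definition grid_cdf (i : nat) : R := cdf_of G (gpt R T i).

Definition grid_gap (t b : nat) : R :=
  gap G theta (x t) (fine ('E_P[V0 t])%E) (gpt R T b).

Lemma measurable_won_lost t : measurable_fun setT (won_lost t).
Proof.
apply: measurable_fun_pair; last exact: measurable_funP.
by apply: measurable_fun_pair; exact: measurable_funP.
Qed.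

Lemma measurable_obs_at t b o : measurable [set w | obs_at t b w = o].
Proof.
have := @measurable_won_lost t measurableT _ (measurable_obs3 T2 (gpt R T b) o).
by rewrite setTI.
Qed.

Lemma gpt_itv i : (i <= T)%N -> 0 <= gpt R T i <= 1.
Proof.
move=> iT; rewrite divr_ge0 //= ler_pdivrMr ?(T_gt0 R T2) //.
by rewrite mul1r ler_nat.
Qed.

Lemma gpt_mono i j : (i <= j)%N -> gpt R T i <= gpt R T j.
Proof. by move=> ij; rewrite ler_pM2r ?invr_gt0 ?(T_gt0 R T2) // ler_nat. Qed.

Definition realized (t : nat) (b : R) (w : Omega) : R :=
  if M t w <= b then V1 t w else V0 t w.

Lemma measurable_realized t b : measurable_fun setT (realized t b).
Proof.
apply: measurable_fun_ifT => //; try exact: measurable_funP.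
by apply: measurable_fun_ler => //; exact: measurable_funP.
Qed.

(** The test [0 <= M t w] makes the payment nonnegative everywhere, not just almost surely, and
    matches the domain [[0, b]] of [partial_mean]. *)
Definition paid (t : nat) (b : R) (w : Omega) : R :=
  if 0 <= M t w <= b then M t w else 0.

Lemma measurable_paid t b : measurable_fun setT (paid t b).
Proof.
apply: measurable_fun_ifT => //.
apply: measurable_and; apply: measurable_fun_ler => //; exact: measurable_funP.
Qed.

Lemma integrable_itv (f : Omega -> R) : measurable_fun setT f ->
  (forall w, `|f w| <= 2) -> P.-integrable setT (EFin \o f).
Proof.
move=> mf f2; apply: measurable_bounded_integrable => //.
  by rewrite -ge0_fin_numE // fin_num_measure.
exists 2; split; first exact: num_real.
by move=> r r2 w _ /=; rewrite (le_trans (f2 w)) // ltW.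
Qed.

Lemma expect_paid t b : 0 <= b <= 1 ->
  (\int[P]_w (paid t b w)%:E = (partial_mean G b)%:E)%E.
Proof.
move=> /andP[b0 b1].
have mI : measurable (`[0, b]%classic : set R) by exact: measurable_itv.
have fin : (\int[G]_(m in `[0%R, b]%classic) m%:E)%E \is a fin_num.
  by apply: (integral_id_fin G (hi := b)) => // m /=; rewrite in_itv.
rewrite /partial_mean /= fineK //.
transitivity (\int[pushforward P (M t)]_(m in `[0%R, b]%classic) m%:E)%E; last first.
  apply: eq_measure_integral => A mA _; rewrite /pushforward.
  exact: M_law.
rewrite ge0_integral_pushforward //; last first.
  by move=> m; rewrite inE /= in_itv /= lee_fin => /andP[].
rewrite [RHS]integral_mkcond; apply: eq_integral => w _.
rewrite /paid patchE.
have -> : (w \in M t @^-1` `[0, b]) = (0 <= M t w <= b).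
  by apply/idP/idP; rewrite inE /= in_itv.
by case: ifP.
Qed.

(** Almost surely the payoff is the realized outcome minus the payment. Adding the mean payment
    [partial_mean G b] back to the payoff formula isolates the mean outcome. *)
Lemma expect_realized t b : 0 <= b <= 1 ->
  (\int[P]_w (realized t b w)%:E =
   (cdf_of G b * dotv theta (x t) + fine ('E_P[V0 t])%E)%:E)%E.
Proof.
move=> b01; have /andP[b0 b1] := b01.
have paid01 w : 0 <= paid t b w <= 1.
  rewrite /paid; case: ifP => [/andP[-> h]|_]; rewrite ?lexx ?ler01 //=.
  exact: le_trans h b1.
have real01 w : 0 <= realized t b w <= 1.
  by rewrite /realized; have [h1 h0] := V01 t w; case: ifP.
have ip : P.-integrable setT (EFin \o paid t b).
  apply: integrable_itv; first exact: measurable_paid.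
  by move=> w; have /andP[h1 h2] := paid01 w; rewrite ger0_norm //; lra.
have ir : P.-integrable setT (EFin \o realized t b).
  apply: integrable_itv; first exact: measurable_realized.
  by move=> w; have /andP[h1 h2] := real01 w; rewrite ger0_norm //; lra.
have eP : (\int[P]_w (payoff (V1 t w) (V0 t w) (M t w) b)%:E =
    \int[P]_w ((realized t b w)%:E - (paid t b w)%:E))%E.
  apply: ae_eq_integral => //.
  - apply/measurable_EFinP; rewrite /payoff.
    apply: measurable_funD; last exact: measurable_funP.
    apply: measurable_funM.
      by apply: measurable_fun_ifT => //; apply: measurable_fun_ler => //; exact: measurable_funP.
    apply: measurable_funB; last exact: measurable_funP.
    by apply: measurable_funB; exact: measurable_funP.
  - apply/measurable_EFinP; apply: measurable_funB; first exact: measurable_realized.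
    exact: measurable_paid.
  exists (~` (M t @^-1` `[0, 1]%classic)); split.
  - by apply: measurableC; apply: measurable_rv; exact: measurable_itv.
  - have z : P (~` (M t @^-1` `[0, 1]%classic)) = 0%E.
      rewrite probability_setC; last by apply: measurable_rv; exact: measurable_itv.
      by rewrite M_law // G01 subee.
    exact: z.
  - move=> w /= h; rewrite in_itv /= => /andP[m0 m1]; apply: h => _.
    rewrite -EFinB; congr EFin; rewrite /payoff /realized /paid m0 /=.
    by case: ifP => _; ring.
have := payoffE t b01; rewrite expectation.unlock eP integralB // expect_paid //.
have fr : (\int[P]_w (realized t b w)%:E)%E \is a fin_num by exact: integrable_fin_num.
rewrite -(fineK fr) -EFinB => -[h]; congr EFin.
by move: h; rewrite /rbar; lra.
Qed.

Theorem obs_environment :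
  environment theta x grid_cdf (fun t => fine ('E_P[V0 t])%E) obs_ker grid_gap.
Proof.
have T0 := T_gt0 R T2.
split => //.
- by move=> i j /andP[ij jT]; apply: cdf_mono; exact: gpt_mono.
- by move=> i _; exact: cdf_itv.
- by move=> t b o; exact: fine_ge0.
- by move=> t b _; exact: sum_fibers (measurable_obs_at t b).
- move=> t b bT; have b01 := gpt_itv bT.
  have := expect_realized t b01; rewrite -/(grid_cdf b); set X := _ + _ => EX.
  have lev0 (o : outcome T) : 0 <= level R o by rewrite divr_ge0.
  have lev1 (o : outcome T) : 0 <= level R o + T%:R^-1 by rewrite addr_ge0 ?invr_ge0.
  have h1 := expect_fibers P (measurable_obs_at t b) lev0.
  have h2 := expect_fibers P (measurable_obs_at t b) lev1.
  have s1 : \sum_o obs_ker t b o = 1 := sum_fibers P (measurable_obs_at t b).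
  have e2 : \sum_o fine (P [set w | obs_at t b w = o]) * (level R o + T%:R^-1) =
     \sum_o obs_ker t b o * level R o + T%:R^-1.
    rewrite -[X in _ = _ + X]mul1r -s1 mulr_suml -big_split /=.
    by apply: eq_bigr => o _; rewrite mulrDr.
  rewrite e2 in h2.
  have pt w : level R (obs_at t b w) <= realized t (gpt R T b) w <=
      level R (obs_at t b w) + T%:R^-1.
    have [v1 v0] := V01 t w.
    by have := level_obs T2 (gpt R T b) (z := won_lost t w) v1 v0;
      rewrite /realized /obs_at /=; lra.
  have mr : measurable_fun setT (fun w => (realized t (gpt R T b) w)%:E).
    by apply/measurable_EFinP; exact: measurable_realized.
  have g1 : (\int[P]_w (level R (obs_at t b w))%:E <= X%:E)%E.
    rewrite -EX; apply: ge0_le_integral => //.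
    - by move=> w _; rewrite lee_fin.
    - apply/measurable_EFinP; exact: (measurable_fibers (measurable_obs_at t b)).
    - by move=> w _; rewrite lee_fin; case/andP: (pt w).
  have g2 : (X%:E <= \int[P]_w (level R (obs_at t b w) + T%:R^-1)%:E)%E.
    rewrite -EX; apply: ge0_le_integral => //.
    - by move=> w _; rewrite lee_fin; have [v1 v0] := V01 t w; rewrite /realized;
        case: ifP => _; [case/andP: v1|case/andP: v0].
    - apply/measurable_EFinP.
      exact: (measurable_fibers (measurable_obs_at t b) (fun o => level R o + T%:R^-1)).
    - by move=> w _; rewrite lee_fin; case/andP: (pt w).
  move: g1 g2; rewrite h1 h2 !lee_fin /obs_ker => g1 g2.
  by apply/andP; split; lra.
- move=> t b lo hi lohi hib.
  have := expect_fibers P (measurable_obs_at t b)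
    (phi := fun o => (seen o lo hi)%:R) (fun o => ler0n R _).
  have hm : measurable (`]gpt R T lo, gpt R T hi]%classic : set R) by exact: measurable_itv.
  rewrite (eq_integral (fun w => (\1_(M t @^-1` `]gpt R T lo, gpt R T hi]) w)%:E)); last first.
    move=> w _; rewrite /obs_at seen_obs // indicE; congr ((nat_of_bool _)%:R%:E).
    by apply/idP/idP; rewrite inE /= in_itv.
  rewrite integral_indic //; last exact: measurable_rv.
  rewrite setIT => h; have e := etrans (esym h) (M_law t hm).
  by rewrite /obs_ker /grid_cdf cdf_diff ?gpt_mono // -e.
- move=> t y lo b hi /andP[lob bhi] hiT by_ cl.
  have bT := leq_trans bhi hiT.
  apply: gap_le => //; first exact: gpt_itv.
  by rewrite !gpt_mono.
Qed.

End Kernel.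

(** * The policy and the law of its history *)

Section Policy.
Variables (R : realType) (d T : nat).

(** History entries contain the seeds, so past actions are redrawn rather than inferred from bids,
    which several actions may share. *)
Definition state_of (h : seq (hentry R d)) : state R d T :=
  foldl (fun st e =>
    let: (xt, u, b, won, y, pay) := e in
    upd st xt (draw st xt u) (obs T won y pay)) (st0 R d T) h.

Definition bidder : policy R d := fun t h xt u =>
  gpt R T (bid_idx (state_of h) xt (draw (state_of h) xt u)).

End Policy.

Lemma bidder_itv (R : realType) (d T t : nat) h xt u :
  0 <= bidder (R := R) (d := d) T t h xt u <= 1.
Proof.
rewrite /bidder; set i := bid_idx _ _ _.
have iT : (i <= T)%N.
  rewrite /i /bid_idx; case: ifP => // _.
  by case: (draw _ _ _) => [[k []]|]; exact: geq_minl.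
rewrite /gpt divr_ge0 //=; case: (posnP T) => [T00|T0].
  have -> : T%:R = 0 :> R by rewrite T00.
  by rewrite invr0 mulr0 ler01.
by rewrite ler_pdivrMr ?ltr0n // mul1r ler_nat.
Qed.

Section Run.
Variables (R : realType) (d T : nat) (theta : 'rV[R]_d) (x : nat -> 'rV[R]_d).
Variable G : probability R R.
Variables (dO : measure_display) (Omega : measurableType dO).
Variables (P : probability Omega R) (V1 V0 M U : nat -> {RV P >-> R}).
Hypothesis d0 : (0 < d)%N.
Hypothesis T2 : (2 <= T)%N.
Hypothesis theta1 : in_unit_ball theta.
Hypothesis x1 : forall t, in_unit_ball (x t).
Hypothesis Uunif : forall t r, 0 <= r <= 1 -> P [set w | U t w <= r] = r%:E.
Hypothesis indep : mutually_independent P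
  (fun i : nat * bool =>
     if i.2 then gen_events (U i.1)
     else gen_events (fun w => (V1 i.1 w, V0 i.1 w, M i.1 w))).

Local Notation hist := (history (bidder T) x (fun t => V1 t) (fun t => V0 t)
  (fun t => M t) (fun t => U t)).
Local Notation bids := (bid (bidder T) x (fun t => V1 t) (fun t => V0 t)
  (fun t => M t) (fun t => U t)).

Let signal : finType := (action T * outcome T)%type.
Let sig0 : signal := (None, (None, ord0)).

Definition after (l : seq signal) : state R d T :=
  (foldl (fun p (s : signal) => (p.1.+1, upd p.2 (x p.1) s.1 s.2))
    (0%N, st0 R d T) l).2.

Lemma after_rcons l s :
  after (rcons l s) = upd (after l) (x (size l)) s.1 s.2.
Proof.
rewrite /after foldl_rcons /=; congr (upd _ (x _) _ _).
elim/last_ind: l => // l s' IH.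
by rewrite foldl_rcons /= IH size_rcons.
Qed.

Fixpoint trace (t : nat) (w : Omega) : seq signal :=
  if t is t'.+1 then
    let st := after (trace t' w) in
    let a := draw st (x t') (U t' w) in
    rcons (trace t' w) (a, obs_at T V1 V0 M t' (bid_idx st (x t') a) w)
  else [::].

Lemma size_trace t w : size (trace t w) = t.
Proof. by elim: t => //= t IH; rewrite size_rcons IH. Qed.

Lemma state_of_history t w : state_of T (hist t w) = after (trace t w).
Proof.
elim: t => // t IH.
rewrite [trace t.+1 w]/= after_rcons size_trace /= /state_of foldl_rcons.
rewrite -/(state_of T (hist t w)) {1}/entry_of IH; congr upd.
rewrite /obs_at /obs3 /= /bid_of /bidder IH /=.
by case: ifP.
Qed.

Lemma bidE t w : bids t w =
  gpt R T (bid_idx (after (trace t w)) (x t) (last sig0 (trace t.+1 w)).1).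
Proof. by rewrite /bid /bid_of /bidder state_of_history /= last_rcons. Qed.

(* The algorithm acts on rounded observations, so its history takes finitely many
   values, and each value is an intersection of independent events. *)
Definition path_set (l : seq signal) : set Omega := [set w | trace (size l) w = l].

Definition draw_set (l : seq signal) (a : action T) : set Omega :=
  [set w | draw (after l) (x (size l)) (U (size l) w) = a].

Definition obs_set (l : seq signal) (s : signal) : set Omega :=
  [set w | obs_at T V1 V0 M (size l) (bid_idx (after l) (x (size l)) s.1) w = s.2].

Lemma path_set_rcons l s :
  path_set (rcons l s) = path_set l `&` (draw_set l s.1 `&` obs_set l s).
Proof.
rewrite /path_set size_rcons; apply/seteqP; split => w /=.
  by move=> /rcons_inj [e <-] /=; rewrite /draw_set /obs_set /= e.
case=> e []; rewrite /draw_set /obs_set /= e => -> ->.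
by case: s.
Qed.

Fixpoint indices (t : nat) : seq (nat * bool) :=
  if t is t'.+1 then [:: (t', true), (t', false) & indices t'] else [::].

(** Along a fixed path [l] every bid is a constant. Adaptivity thus disappears: each event concerns
    a single seed or a single tuple, as [mutually_independent] requires. *)
Definition event (l : seq signal) (i : nat * bool) : set Omega :=
  let l' := take i.1 l in let s := nth sig0 l i.1 in
  if i.2 then draw_set l' s.1 else obs_set l' s.

Lemma mem_indices t i : (i \in indices t) = (i.1 < t)%N.
Proof.
elim: t => //= t IH; rewrite !inE IH ltnS (leq_eqVlt i.1); case: i {IH} => i b.
by rewrite !xpair_eqE /=; case: b; rewrite ?andbT ?andbF ?orbF.
Qed.

Lemma uniq_indices t : uniq (indices t).
Proof. by elim: t => //= t ->; rewrite !inE !mem_indices xpair_eqE /= ltnn andbF. Qed.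

Lemma event_rcons l s i : (i.1 < size l)%N -> event (rcons l s) i = event l i.
Proof.
move=> h; rewrite /event nth_rcons h -cats1 takel_cat //; exact: ltnW.
Qed.

Lemma event_last l s b :
  event (rcons l s) (size l, b) = if b then draw_set l s.1 else obs_set l s.
Proof.
by rewrite /event /= nth_rcons ltnn eqxx -cats1 takel_cat // take_size.
Qed.

Lemma path_set_bigcap l :
  path_set l = \bigcap_(i in [set i | i \in indices (size l)]) event l i.
Proof.
elim/last_ind: l => [|l s IH].
  by apply/seteqP; split => w // _ i.
rewrite path_set_rcons IH size_rcons; apply/seteqP; split => w.
  case=> h [h1 h2] i /=; rewrite !inE => /orP[/eqP->|/orP[/eqP->|hi]].
  - by rewrite event_last.
  - by rewrite event_last.
  - by rewrite event_rcons ?mem_indices -?mem_indices //; exact: h.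
move=> h; split.
  move=> i /= hi; rewrite -(event_rcons s); last by rewrite -mem_indices.
  by apply: h; rewrite /= !inE hi !orbT.
split; first by have := h (size l, true); rewrite /= event_last; apply; rewrite !inE eqxx.
by have := h (size l, false); rewrite /= event_last; apply; rewrite !inE eqxx orbT.
Qed.

Lemma event_gen l i :
  (if i.2 then gen_events (U i.1)
   else gen_events (fun w => (V1 i.1 w, V0 i.1 w, M i.1 w))) (event l i) \/
  (size l < i.1)%N.
Proof.
have [h|h] := leqP i.1 (size l); [left|by right].
have sz : size (take i.1 l) = i.1 by rewrite size_takel.
rewrite /event; case: i h sz => i [] /= h sz.
  rewrite /draw_set sz; set st := after _; set a := _.1.
  exists [set u | draw st (x i) u = a]; split => //; exact: measurable_sample.
rewrite /obs_set sz; set st := after _; set s := nth _ _ _.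
exists [set z | obs3 T (gpt R T (bid_idx st (x i) s.1)) z = s.2]; split => //.
exact: measurable_obs3.
Qed.

Lemma prob_path l :
  fine (P (path_set l)) = \prod_(i <- indices (size l)) fine (P (event l i)).
Proof.
rewrite path_set_bigcap; apply: (indep (A := event l)); first exact: uniq_indices.
move=> i; rewrite mem_indices => h; case: (event_gen l i) => // h'.
by move: (ltn_trans h h'); rewrite ltnn.
Qed.

Lemma prob_path_rcons l s :
  fine (P (path_set (rcons l s))) =
  fine (P (path_set l)) * (action_prob (after l) (x (size l)) s.1 *
    obs_ker V1 V0 M (size l) (bid_idx (after l) (x (size l)) s.1) s.2).
Proof.
rewrite !prob_path size_rcons /= !big_cons !event_last mulrA mulrC; congr (_ * _).
  by apply: eq_big_seq => i; rewrite mem_indices => h; rewrite event_rcons.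
congr (_ * _).
exact: (congr1 fine (draw_law T2 d0 (@Uunif (size l)) (after l) (x (size l)) s.1)).
Qed.

Lemma measurable_draw_set l a : measurable (draw_set l a).
Proof. exact: (measurable_rv (U (size l)) (measurable_sample _ _ _ _)). Qed.

Lemma measurable_path l : measurable (path_set l).
Proof.
elim/last_ind: l => [|l s IH].
  by rewrite (_ : path_set [::] = setT) //; apply/seteqP; split.
rewrite path_set_rcons; apply: measurableI => //; apply: measurableI.
  exact: measurable_draw_set.
exact: measurable_obs_at.
Qed.

Lemma measurable_trace t (A : Type) (phi : seq signal -> A) (B : set A) :
  measurable [set w | B (phi (trace t w))].
Proof.
have -> : [set w | B (phi (trace t w))] =
    \bigcup_(l in [set l : t.-tuple signal | B (phi l)]) path_set l.
  apply/seteqP; split => w /=.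
    have e := size_trace t w.
    move=> h; exists (Tuple (introT eqP e)) => //=.
    by rewrite /path_set /= e.
  by case=> l /= h; rewrite /path_set /= size_tuple => ->.
apply: fin_bigcup_measurable; first exact: finite_finset.
by move=> l _; exact: measurable_path.
Qed.

Let bid_of_trace (t : nat) (l : seq signal) : R :=
  gpt R T (bid_idx (after (take t l)) (x t) (last sig0 l).1).

Lemma bid_traceE t w : bids t w = bid_of_trace t (trace t.+1 w).
Proof.
rewrite bidE /bid_of_trace /= -[in take _ _]cats1 takel_cat ?size_trace //.
by rewrite -[X in take X](size_trace t w) take_size.
Qed.

Lemma measurable_bid_comp t (f : R -> R) :
  measurable_fun setT (fun w => f (bids t w)).
Proof.
move=> _ B mB; rewrite setTI.
rewrite (_ : _ @^-1` B = [set w | B ((f \o bid_of_trace t) (trace t.+1 w))]).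
  exact: measurable_trace.
by apply/seteqP; split => w /=; rewrite bid_traceE.
Qed.

Let cost (t : nat) (w : Omega) : R :=
  gap G theta (x t) (fine ('E_P[V0 t])%E) (bids t w).

Local Notation rtgP := (rtg x (obs_ker V1 V0 M) (grid_gap T theta x G V0)).

Lemma cost_ge0 t w : 0 <= cost t w.
Proof. by apply: gap_ge0 => //; exact: bidder_itv. Qed.

Lemma measurable_cost t : measurable_fun setT (cost t).
Proof. exact: measurable_bid_comp. Qed.

Lemma measurable_costs t r :
  measurable_fun setT (fun w => (\sum_(i < r) cost (t + i) w)%:E).
Proof.
apply/measurable_EFinP; apply: measurable_sum => i; exact: measurable_cost.
Qed.

Lemma cost_path l s w : path_set (rcons l s) w ->
  cost (size l) w =
  grid_gap T theta x G V0 (size l) (bid_idx (after l) (x (size l)) s.1).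
Proof.
rewrite /path_set /= size_rcons => e; rewrite /cost bid_traceE e /bid_of_trace.
by rewrite last_rcons -cats1 takel_cat // take_size.
Qed.

(** Integrals over path events replace conditional expectations, so paths of probability 0 need no
    separate treatment. Splitting a path event by the next signal reproduces the recursion of
    [rtg]. *)
Lemma expected_cost r l :
  (\int[P]_(w in path_set l) (\sum_(i < r) cost (size l + i) w)%:E)%E =
  (fine (P (path_set l)) * rtgP r (size l) (after l))%:E.
Proof.
elim: r l => [|r IH] l.
  rewrite mulr0 (eq_integral (cst 0%E)) ?integral0 // => w _.
  by rewrite big_ord0.
have msig s : measurable [set w | last sig0 (trace (size l).+1 w) = s].
  exact: (@measurable_trace (size l).+1 signal (last sig0) [set s]).
rewrite (integral_fibers P msig) //; last 3 first.
- exact: measurable_path.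
- exact: measurable_funTS (measurable_costs _ _).
- by move=> w _; rewrite lee_fin sumr_ge0 // => i _; exact: cost_ge0.
have fib s : path_set l `&` [set w | last sig0 (trace (size l).+1 w) = s] =
    path_set (rcons l s).
  apply/seteqP; split => w; rewrite /path_set /= size_rcons /= last_rcons.
    by case=> -> ->.
  by move=> /rcons_inj [].
under eq_bigr => s _ do rewrite fib.
rewrite rtgS -step_sum mulr_sumr -sumEFin; apply: eq_bigr => s _.
set gs := grid_gap T theta x G V0 (size l) (bid_idx (after l) (x (size l)) s.1).
rewrite (eq_integral (fun w => gs%:E + (\sum_(i < r) cost (size (rcons l s) + i) w)%:E)%E);
  last first.
  move=> w; rewrite inE => hw; rewrite -EFinD; congr EFin.
  rewrite big_ord_recl addn0 (cost_path hw); congr (_ + _).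
  by apply: eq_bigr => i _; rewrite size_rcons addSnnS.
have mp : measurable (path_set (rcons l s)) by exact: measurable_path.
rewrite ge0_integralD //; last 3 first.
- by move=> w hw; rewrite lee_fin /gs -(cost_path hw) cost_ge0.
- by move=> w _; rewrite lee_fin sumr_ge0 // => i _; exact: cost_ge0.
- exact: measurable_funTS (measurable_costs _ _).
rewrite IH integral_cst // after_rcons.
have pE : P (path_set (rcons l s)) = (fine (P (path_set (rcons l s))))%:E.
  by rewrite fineK // fin_num_measure.
apply: (etrans (congr1 (fun z => gs%:E * z + _)%E pE)).
rewrite -EFinM -EFinD prob_path_rcons size_rcons; congr EFin.
rewrite -/gs; ring.
Qed.

Lemma expected_regret :
  ('E_P[fun w => (\sum_(t < T) cost t w)%R] = (rtgP T 0 (st0 R d T))%:E)%E.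
Proof.
rewrite expectation.unlock.
have E0 : path_set [::] = setT by apply/seteqP; split.
have := expected_cost T [::]; rewrite E0 /= => ->.
rewrite /after /=; congr EFin.
have -> : fine (P setT) = 1 by rewrite probability_setT.
by rewrite mul1r.
Qed.

End Run.

Theorem theorem1 (R : realType) (om la : R) :
  0 < om < 1 -> 0 < la < 1 ->
  exists C : R, 0 < C /\
  exists alg : forall d T : nat, policy R d,
    (forall d T t h xt u, 0 <= alg d T t h xt u <= 1) /\
    forall (d T : nat) (theta : 'rV[R]_d) (x : nat -> 'rV[R]_d)
      (G : probability R R)
      (dO : measure_display) (Omega : measurableType dO)
      (P : probability Omega R) (V1 V0 M U : nat -> {RV P >-> R}),
      (0 < d)%N -> (2 <= T)%N ->
      in_unit_ball theta ->
      (forall t, in_unit_ball (x t)) ->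
      (* HOB distribution G on [0,1], (om,la)-locally bounded *)
      G `[0, 1]%classic = 1%E ->
      locally_bounded G om la ->
      (* outcomes in [0,1] *)
      (forall t w, 0 <= V1 t w <= 1 /\ 0 <= V0 t w <= 1) ->
      (* m_t has law G *)
      (forall t (A : set R), measurable A -> P (M t @^-1` A) = G A) ->
      (* linear model *)
      (forall t, ('E_P[V1 t] - 'E_P[V0 t] = (dotv theta (x t))%:E)%E) ->
      (* expected payoff formula *)
      (forall t b, 0 <= b <= 1 ->
         ('E_P[fun w => payoff (V1 t w) (V0 t w) (M t w) b] =
          (rbar G theta (x t) (fine ('E_P[V0 t])%E) b)%:E)%E) ->
      (* algorithm's seeds: uniform on [0,1] *)
      (forall t w, 0 <= U t w <= 1) ->
      (forall t r, 0 <= r <= 1 -> P [set w | U t w <= r] = r%:E) ->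
      (* independence across rounds of the tuples (v1,v0,m), and of the seeds *)
      mutually_independent P
        (fun i : nat * bool =>
           if i.2 then gen_events (U i.1)
           else gen_events (fun w => (V1 i.1 w, V0 i.1 w, M i.1 w))) ->
      let b := bid (alg d T) x (fun t => V1 t) (fun t => V0 t) (fun t => M t) (fun t => U t) in
      (forall t, measurable_fun setT (b t)) /\
      ('E_P[fun w => (\sum_(t < T)
                gap G theta (x t) (fine ('E_P[V0 t])%E) (b t w))%R]
       <= (C * (Num.sqrt (d%:R * T%:R) * ln T%:R ^+ 3
                + d%:R * ln T%:R ^+ 5))%:E)%E.
Proof.
move=> _ _; exists (regret_const R); split; first exact: regret_const_gt0.
exists (fun d T => bidder T); split; first by move=> *; exact: bidder_itv.
move=> d T theta x G dO Omega P V1 V0 M U d0 T2 theta1 x1 G01 _ V01 Mlaw _ payE _ Uunif.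
move=> indep b; split=> [t|]; first exact: (measurable_bid_comp x V1 V0 M U T2 t id).
rewrite /b (expected_regret G d0 T2 theta1 x1 Uunif indep) lee_fin.
have env := obs_environment d0 T2 theta1 x1 G01 V01 Mlaw payE.
have C0 : 0 <= regret_const R := ltW (regret_const_gt0 R).
have L0 : 0 <= ln T%:R :> R by rewrite ln_ge0 // ler1n ltnW.
apply: (@le_trans _ _ (regret_const R * (Num.sqrt (d%:R * T%:R) * ln T%:R ^+ 3))).
  have [dT|Td] := leqP d T.
    exact: le_trans (rtg_bound env) (final_rate R T2 d0 dT).
  apply: (le_trans (rtg_le2 env _ _ _)); exact: trivial_rate.
by rewrite ler_wpM2l // lerDl mulr_ge0 // exprn_ge0.
Qed.
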